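(* Let $S$ be a finitely presented regular monoid with finitely many left ideals and finitely many right ideals. If every maximal subgroup of $S$ satisfies the homological finiteness condition $\mathrm{FP}_3$, then so does $S$.
   Context: A semigroup $S$ is regular if for every $x\in S$ there is $y\in S$ with $xyx=x$. The maximal subgroups of $S$ are the $\mathcal H$-classes (Green's relation) of $S$ containing an idempotent. A monoid $M$ satisfies $\mathrm{FP}_3$ if the trivial left $\mathbb ZM$-module $\mathbb Z$ has a projective resolution $\cdots\to P_3\to P_2\to P_1\to P_0\to\mathbb Z\to 0$ with $P_0,P_1,P_2,P_3$ finitely generated. *)

(* Defs.v *)
From HB Require Import structures.
From mathcomp Require Import all_boot all_order all_algebra finmap.
From mathcomp Require Import all_classical.
From mathcomp.multinomials Require Import monalg.

Set Implicit Arguments.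
Unset Strict Implicit.
Unset Printing Implicit Defensive.

Import GRing.Theory.
Local Open Scope ring_scope.

Definition regular_monoid (S : monoidType) : Prop :=
  forall x : S, exists y : S, (x * y * x)%g = x.

Definition left_ideal (S : monoidType) (I : set S) : Prop :=
  (I !=set0)%classic /\ forall s x : S, I x -> I (s * x)%g.

Definition right_ideal (S : monoidType) (I : set S) : Prop :=
  (I !=set0)%classic /\ forall s x : S, I x -> I (x * s)%g.

Section Green.
Variable S : monoidType.
Implicit Types x y : S.

Definition principal_left_ideal x : set S := range (fun s : S => (s * x)%g).
Definition principal_right_ideal x : set S := range (fun s : S => (x * s)%g).

Definition greenL x y := principal_left_ideal x = principal_left_ideal y.
Definition greenR x y := principal_right_ideal x = principal_right_ideal y.
Definition greenH x y := greenL x y /\ greenR x y.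

Definition Hclass x : set S := [set y | greenH x y]%classic.

Lemma greenLP x y :
  greenL x y <-> (exists s, x = (s * y)%g) /\ (exists t, y = (t * x)%g).
Proof.
split=> [Lxy|[[s ->] [t tE]]].
  split.
    have : principal_left_ideal x x by exists 1%g => //; rewrite mul1g.
    by rewrite Lxy => -[s _ <-]; exists s.
  have : principal_left_ideal y y by exists 1%g => //; rewrite mul1g.
  by rewrite -Lxy => -[s _ <-]; exists s.
apply/seteqP; split=> _ [r _ <-] /=; first by exists (r * s)%g => //; rewrite mulgA.
by exists (r * t)%g => //; rewrite -mulgA -tE.
Qed.

Lemma greenRP x y :
  greenR x y <-> (exists s, x = (y * s)%g) /\ (exists t, y = (x * t)%g).
Proof.
split=> [Rxy|[[s ->] [t tE]]].
  split.
    have : principal_right_ideal x x by exists 1%g => //; rewrite mulg1.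
    by rewrite Rxy => -[s _ <-]; exists s.
  have : principal_right_ideal y y by exists 1%g => //; rewrite mulg1.
  by rewrite -Rxy => -[s _ <-]; exists s.
apply/seteqP; split=> _ [r _ <-] /=; first by exists (s * r)%g => //; rewrite mulgA.
by exists (t * r)%g => //; rewrite mulgA -tE.
Qed.

Variables (e : S) (ee : (e * e)%g = e).

Lemma Hclass_idl x : Hclass e x -> (e * x)%g = x.
Proof. by case=> _ /greenRP[_ [t ->]]; rewrite mulgA ee. Qed.

Lemma Hclass_idr x : Hclass e x -> (x * e)%g = x.
Proof. by case=> /greenLP[_ [t ->]] _; rewrite -mulgA ee. Qed.

Lemma Hclass_id : Hclass e e. Proof. by []. Qed.

Lemma Hclass_mul x y : Hclass e x -> Hclass e y -> Hclass e (x * y)%g.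
Proof.
move=> Hx Hy; have [/greenLP[[a ea] _] /greenRP[[b eb] _]] := Hx.
have [/greenLP[[c ec] _] /greenRP[[d ed] _]] := Hy.
split; [apply/greenLP | apply/greenRP]; split.
- by exists (c * a)%g; rewrite -[RHS]mulgA [(a * _)%g]mulgA -ea (Hclass_idl Hy).
- by exists (x * y)%g; rewrite -mulgA (Hclass_idr Hy).
- by exists (d * b)%g; rewrite [RHS]mulgA -[(x * y * d)%g]mulgA -ed (Hclass_idr Hx).
- by exists (x * y)%g; rewrite mulgA (Hclass_idl Hx).
Qed.

Lemma Hclass_inv x : Hclass e x ->
  exists y, [/\ Hclass e y, (x * y)%g = e & (y * x)%g = e].
Proof.
move=> Hx; have [/greenLP[[a ea] _] /greenRP[[b eb] _]] := Hx.
have aebE : (a * e)%g = (e * b)%g by rewrite {1}eb mulgA -ea.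
have xy : (x * (e * b))%g = e by rewrite mulgA (Hclass_idr Hx) -eb.
have yx : (e * b * x)%g = e.
  by rewrite -aebE -mulgA (Hclass_idl Hx) -ea.
exists (e * b)%g; split=> //; split; [apply/greenLP | apply/greenRP]; split.
- by exists x; rewrite xy.
- by exists a; rewrite aebE.
- by exists x; rewrite yx.
- by exists b.
Qed.

End Green.

(* The H-class of the idempotent e, as a type; its identity is e. *)
Definition maximal_subgroup (S : monoidType) (e : S) (ee : (e * e)%g = e) :
  Type := set_type (Hclass e).

Section MaximalSubgroup.
Variables (S : monoidType) (e : S) (ee : (e * e)%g = e).
Local Notation G := (maximal_subgroup ee).

HB.instance Definition _ := Choice.on G.

Definition ms_one : G := exist _ e (mem_set (Hclass_id e)).
Definition ms_mul (x y : G) : G :=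
  exist _ (sval x * sval y)%g
    (mem_set (Hclass_mul ee (set_mem (svalP x)) (set_mem (svalP y)))).

Lemma ms_mulA : associative ms_mul.
Proof. by move=> x y z; apply: val_inj; rewrite /= mulgA. Qed.
Lemma ms_mul1 : left_id ms_one ms_mul.
Proof.
by move=> x; apply: val_inj; apply: (Hclass_idl ee); apply: set_mem (svalP x).
Qed.
Lemma ms_1mul : right_id ms_one ms_mul.
Proof.
by move=> x; apply: val_inj; apply: (Hclass_idr ee); apply: set_mem (svalP x).
Qed.

HB.instance Definition _ := isMonoid.Build G ms_mulA ms_mul1 ms_1mul.

Definition ms_inv (x : G) : G :=
  let w := cid (Hclass_inv ee (set_mem (svalP x))) in
  exist _ (sval w) (mem_set (let: And3 h _ _ := svalP w in h)).

Lemma ms_mulVg : left_inverse ms_one ms_inv ms_mul.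
Proof. by move=> x; apply: val_inj; rewrite /=; case: cid => y []. Qed.
Lemma ms_mulgV : right_inverse ms_one ms_inv ms_mul.
Proof. by move=> x; apply: val_inj; rewrite /=; case: cid => y []. Qed.

HB.instance Definition _ := hasInv.Build G ms_inv.
HB.instance Definition _ := Monoid_isGroup.Build G ms_mulVg ms_mulgV.

End MaximalSubgroup.

Inductive congruence (A : eqType) (R : seq (seq A * seq A)) :
    seq A -> seq A -> Prop :=
| congruence_rel u v : (u, v) \in R -> congruence R u v
| congruence_refl u : congruence R u u
| congruence_sym u v : congruence R u v -> congruence R v u
| congruence_trans u v w :
    congruence R u v -> congruence R v w -> congruence R u w
| congruence_cat u u' v v' :
    congruence R u u' -> congruence R v v' -> congruence R (u ++ v) (u' ++ v').

(* S is isomorphic to the quotient of the free monoid seq A by the congruence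
   generated by R, the isomorphism being induced by f. *)
Definition finitely_presented (S : monoidType) : Prop :=
  exists (A : finType) (R : seq (seq A * seq A)) (f : A -> S),
    let eval (w : seq A) := (\prod_(a <- w) f a)%g in
    (forall s : S, exists w, eval w = s) /\
    (forall u v, eval u = eval v <-> congruence R u v).

(* The product provided by monalg requires a monoid in which x y = 1 implies
   x = y = 1, hence the new type. *)
Definition monoid_ring (S : monoidType) : Type := {malg int[S]}.

Section MonoidRing.
Variable S : monoidType.
Local Notation ZS := (monoid_ring S).
Implicit Types g : ZS.

HB.instance Definition _ := GRing.Zmodule.on ZS.

Definition mr_one : ZS := mkmalgU (1%g : S) (1 : int).

Definition mr_mul g1 g2 : ZS :=
  \sum_(k1 <- msupp g1) \sum_(k2 <- msupp g2)
     mkmalgU (k1 * k2)%g (g1@_k1 * g2@_k2).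


Lemma mr_mulw (d1 d2 : {fset S}) g1 g2 :
  (msupp g1 `<=` d1)%fset -> (msupp g2 `<=` d2)%fset ->
  mr_mul g1 g2 = \sum_(k1 <- d1) \sum_(k2 <- d2)
     mkmalgU (k1 * k2)%g (g1@_k1 * g2@_k2).
Proof.
move=> le_d1 le_d2; rewrite /mr_mul (big_fset_incl _ le_d1) /=.
  apply/eq_bigr=> k1 _; apply/big_fset_incl => // k _ /mcoeff_outdom ->.
  by rewrite mulr0 monalgU0.
move=> k _ /mcoeff_outdom g1k.
by rewrite big1 => // k' _; rewrite g1k mul0r monalgU0.
Qed.

Lemma mr_mul0g : left_zero 0 mr_mul.
Proof. by move=> g; rewrite /mr_mul msupp0 big_seq_fset0. Qed.

Lemma mr_mulg0 : right_zero 0 mr_mul.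
Proof.
by move=> g; rewrite /mr_mul exchange_big /= msupp0 big_seq_fset0.
Qed.

Lemma mr_mulDl : left_distributive mr_mul +%R.
Proof.
move=> g1 g2 g.
rewrite [in RHS](mr_mulw (fsubsetUl _ (msupp g2)) (fsubset_refl _)).
rewrite [in RHS](mr_mulw (fsubsetUr (msupp g1) _) (fsubset_refl _)).
rewrite (mr_mulw (msuppD_le _ _) (fsubset_refl _)).
rewrite -big_split /=; apply/eq_bigr=> k1 _.
rewrite -big_split /=; apply/eq_bigr=> k2 _.
by rewrite mcoeffD mulrDl monalgUD.
Qed.

Lemma mr_mulDr : right_distributive mr_mul +%R.
Proof.
move=> g g1 g2.
rewrite [in RHS](mr_mulw (fsubset_refl _) (fsubsetUl _ (msupp g2))).
rewrite [in RHS](mr_mulw (fsubset_refl _) (fsubsetUr (msupp g1) _)).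
rewrite (mr_mulw (fsubset_refl _) (msuppD_le _ _)).
rewrite -big_split /=; apply/eq_bigr=> k1 _.
rewrite -big_split /=; apply/eq_bigr=> k2 _.
by rewrite mcoeffD mulrDr monalgUD.
Qed.

Lemma mr_mulUU c1 c2 (k1 k2 : S) :
  mr_mul (mkmalgU k1 c1) (mkmalgU k2 c2) = mkmalgU (k1 * k2)%g (c1 * c2).
Proof. by rewrite (mr_mulw msuppU_le msuppU_le) !big_seq_fset1 !mcoeffUU. Qed.

Lemma mr_mulEl g1 g2 :
  mr_mul g1 g2 = \sum_(k <- msupp g1) mr_mul (mkmalgU k g1@_k) g2.
Proof.
rewrite {1}[g1]monalgE.
by rewrite (big_morph (mr_mul^~ g2) (fun _ _ => mr_mulDl _ _ _) (mr_mul0g _)).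
Qed.

Lemma mr_mulEr g1 g2 :
  mr_mul g1 g2 = \sum_(k <- msupp g2) mr_mul g1 (mkmalgU k g2@_k).
Proof.
rewrite {1}[g2]monalgE.
by rewrite (big_morph (mr_mul g1) (fun _ _ => mr_mulDr _ _ _) (mr_mulg0 _)).
Qed.

Lemma mr_mul1g : left_id mr_one mr_mul.
Proof.
move=> g; rewrite mr_mulEr [RHS]monalgE.
by apply/eq_bigr=> k _; rewrite mr_mulUU mul1r mul1g.
Qed.

Lemma mr_mulg1 : right_id mr_one mr_mul.
Proof.
move=> g; rewrite mr_mulEl [RHS]monalgE.
by apply/eq_bigr=> k _; rewrite mr_mulUU mulr1 mulg1.
Qed.

Lemma mr_mulA : associative mr_mul.
Proof.
move=> g1 g2 g3; rewrite mr_mulEl [mr_mul g1 g2]mr_mulEl.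
rewrite (big_morph (mr_mul^~ _) (fun _ _ => mr_mulDl _ _ _) (mr_mul0g _)).
apply/eq_bigr=> k1 _; rewrite [mr_mul g2 g3]mr_mulEl.
rewrite (big_morph (mr_mul _) (fun _ _ => mr_mulDr _ _ _) (mr_mulg0 _)).
rewrite [mr_mul _ g2]mr_mulEr.
rewrite (big_morph (mr_mul^~ _) (fun _ _ => mr_mulDl _ _ _) (mr_mul0g _)).
apply/eq_bigr=> k2 _; rewrite [mr_mul _ g3]mr_mulEr [RHS]mr_mulEr.
rewrite (big_morph (mr_mul _) (fun _ _ => mr_mulDr _ _ _) (mr_mulg0 _)).
by apply/eq_bigr=> k3 _; rewrite !mr_mulUU mulrA mulgA.
Qed.

Lemma mr_one_neq0 : mr_one != 0.
Proof.
by apply/eqP=> /malgP/(_ 1%g)/eqP; rewrite mcoeffUU mcoeff0 oner_eq0.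
Qed.

HB.instance Definition _ := GRing.Zmodule_isNzRing.Build ZS
  mr_mulA mr_mul1g mr_mulg1 mr_mulDl mr_mulDr mr_one_neq0.

Definition augmentation g : int := \sum_(k <- msupp g) g@_k.

Lemma augmentationw (d : {fset S}) g :
  (msupp g `<=` d)%fset -> augmentation g = \sum_(k <- d) g@_k.
Proof.
by move=> le_d; apply/big_fset_incl => // k _ /mcoeff_outdom.
Qed.

Lemma augmentation0 : augmentation 0 = 0.
Proof. by rewrite /augmentation msupp0 big_seq_fset0. Qed.

Lemma augmentationU (k : S) c : augmentation (mkmalgU k c) = c.
Proof. by rewrite (augmentationw msuppU_le) big_seq_fset1 mcoeffUU. Qed.

Lemma augmentationD : {morph augmentation : g1 g2 / g1 + g2 >-> g1 + g2}.
Proof.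
move=> g1 g2; rewrite (augmentationw (msuppD_le g1 g2)).
rewrite (augmentationw (fsubsetUl _ (msupp g2))).
rewrite (augmentationw (fsubsetUr (msupp g1) _)) -big_split /=.
by apply/eq_bigr=> k _; rewrite mcoeffD.
Qed.

Lemma augmentation1 : augmentation 1 = 1.
Proof. exact: augmentationU. Qed.

Lemma augmentationM : {morph augmentation : g1 g2 / g1 * g2 >-> g1 * g2}.
Proof.
move=> g1 g2; rewrite {1}/GRing.mul /= /mr_mul.
rewrite (big_morph augmentation augmentationD augmentation0) /= mulr_suml.
apply/eq_bigr=> k1 _.
rewrite (big_morph augmentation augmentationD augmentation0) /= mulr_sumr.
by apply/eq_bigr=> k2 _; rewrite augmentationU.
Qed.

End MonoidRing.

(* The abelian group Z on which every s in S acts as the identity. *)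
Definition trivial_module (S : monoidType) : Type := int.

Section TrivialModule.
Variable S : monoidType.
Local Notation Z := (trivial_module S).

HB.instance Definition _ := GRing.Zmodule.on Z.

Definition trivial_scale (c : monoid_ring S) (z : Z) : Z :=
  (augmentation c * z : int).

Lemma trivial_scaleA c1 c2 z :
  trivial_scale c1 (trivial_scale c2 z) = trivial_scale (c1 * c2) z.
Proof. by rewrite /trivial_scale augmentationM mulrA. Qed.
Lemma trivial_scale1 : left_id 1 trivial_scale.
Proof. by move=> z; rewrite /trivial_scale augmentation1 mul1r. Qed.
Lemma trivial_scaleDr : right_distributive trivial_scale +%R.
Proof. by move=> c z1 z2; rewrite /trivial_scale [LHS]mulrDr. Qed.
Lemma trivial_scaleDl z : {morph trivial_scale^~ z : c1 c2 / c1 + c2}.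
Proof. by move=> c1 c2; rewrite /trivial_scale augmentationD [LHS]mulrDl. Qed.

HB.instance Definition _ := GRing.Zmodule_isLmodule.Build (monoid_ring S) Z
  trivial_scaleA trivial_scale1 trivial_scaleDr trivial_scaleDl.
End TrivialModule.

Definition surjective (U V : Type) (f : U -> V) : Prop :=
  forall v, exists u, f u = v.

Definition projective (R : pzRingType) (P : lmodType R) : Prop :=
  forall (M N : lmodType R) (g : {linear M -> N}) (f : {linear P -> N}),
    surjective g -> exists h : {linear P -> M}, forall x, g (h x) = f x.

Definition finitely_generated (R : pzRingType) (M : lmodType R) : Prop :=
  exists (n : nat) (b : 'I_n -> M),
    forall x, exists c : 'I_n -> R, x = \sum_(i < n) c i *: b i.

Definition exact_at (U V W : zmodType) (f : U -> V) (g : V -> W) : Prop :=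
  forall v, g v = 0 <-> exists u, f u = v.

Definition FP (n : nat) (S : monoidType) : Prop :=
  exists (P : nat -> lmodType (monoid_ring S))
         (d : forall i, {linear P i.+1 -> P i})
         (eps : {linear P 0%N -> trivial_module S}),
    [/\ forall i, projective (P i),
        forall i, (i <= n)%N -> finitely_generated (P i),
        surjective eps,
        exact_at (d 0%N) eps
      & forall i, exact_at (d i.+1) (d i)].

(* Main.v *)
From HB Require Import structures.
From mathcomp Require Import all_boot all_order all_algebra finmap.
From mathcomp Require Import all_classical.
From mathcomp.multinomials Require Import monalg.
Require Import Defs.

(** The theorem holds for FP_n for every n, and the proof is a dimension shifting
    along Green's relations.

    Over a group G of type FP_n, every G-lattice A (a ZG-module that is free of
    finite rank over Z) is FP_n: tensor a resolution of Z with A, and untwist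
    the diagonal action on ZG (x) A to see that it is a free module
    ([group_lattice_FPq]).

    Over ZS, every left ideal of S spans a left ideal of ZS that is FP_n for all
    n. Indeed it is a finite union of ideals Se with e idempotent, ZSe is
    projective, and intersections of left ideals are again left ideals of which
    only FP_(n-1) is required ([left_ideal_FPq]). In particular, if L is the
    L-class of e and Se - L the left ideal of elements strictly below it, then
    ZL = Z[Se]/Z[Se - L] is FP_n for all n ([schutz_free_FPq]). As a right module
    over the group ring of the maximal subgroup G at e, ZL is free of finite
    rank, one generator for each R-class meeting L. Hence ZL (x)_ZG - is exact,
    and it carries FP_n modules to FP_n modules ([induced_FPq]).

    The statement proved by induction is that every quotient M = A/B, where A is
    a lattice on which S acts, is FP_n over ZS ([lattice_quot_FPq]). The
    induction is on the annihilator of M in S, an ideal, and S has finitely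
    many. With e outside the annihilator and Se minimal for this, the map
    ZL (x)_ZG eM -> M has a source that is FP_n by the previous steps, and a
    kernel and a cokernel that are killed by e and by the annihilator of M, hence
    are FP_n by induction. For the kernel this uses stability, which follows from
    the finiteness of the number of right ideals ([Lclass_stable]). Torsion has
    to be allowed in M because the cokernel of a map of lattices has torsion; it
    is harmless because kernels and cokernels of such quotients are again
    quotients of lattices. The theorem is the case M = Z.

    Modules are represented throughout as subquotients A/B given by predicates on
    an ambient module, so that kernels, images and quotients require no new
    types. *)

Set Implicit Arguments.
Unset Strict Implicit.
Unset Printing Implicit Defensive.

Import Order.TTheory GRing.Theory Num.Theory.
Local Open Scope ring_scope.

(** * Submodules and subquotients *)

Section Submodule.
Variables (R : pzRingType) (U : lmodType R).

Record submod (A : U -> Prop) : Prop := Submod {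
  submod0 : A 0;
  submodD : forall u v, A u -> A v -> A (u + v);
  submodZ : forall c u, A u -> A (c *: u) }.

Variables (A : U -> Prop) (sA : submod A).

Lemma submodN u : A u -> A (- u).
Proof. by rewrite -scaleN1r; apply: (submodZ sA). Qed.

Lemma submodB u v : A u -> A v -> A (u - v).
Proof. by move=> Au /submodN; apply: (submodD sA). Qed.

Lemma submod_sum (I : Type) (r : seq I) (P : pred I) (F : I -> U) :
  (forall i, A (F i)) -> A (\sum_(i <- r | P i) F i).
Proof. by move=> AF; apply: big_ind => //; [apply: submod0|apply: submodD]. Qed.

(** Quotient modules are never formed: a quotient by A is the ambient module
    with this congruence as its equality. *)
Definition eqmod u v := A (u - v).

Lemma eqmod_refl u : eqmod u u.
Proof. by rewrite /eqmod subrr; apply: submod0. Qed.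

Lemma eqmod_eq u v : u = v -> eqmod u v.
Proof. by move=> ->; apply: eqmod_refl. Qed.

Lemma eqmod_sym u v : eqmod u v -> eqmod v u.
Proof. by rewrite /eqmod -[v - u]opprB; apply: submodN. Qed.

Lemma eqmod_trans u v w : eqmod u v -> eqmod v w -> eqmod u w.
Proof. by move=> /(submodD sA) h /h; rewrite /eqmod addrA subrK. Qed.

Lemma eqmodD u u' v v' : eqmod u u' -> eqmod v v' -> eqmod (u + v) (u' + v').
Proof. by move=> /(submodD sA) h /h; rewrite /eqmod opprD addrACA. Qed.

Lemma eqmodB u u' v v' : eqmod u u' -> eqmod v v' -> eqmod (u - v) (u' - v').
Proof.
move=> uu' /submodN vv'; apply: eqmodD => //.
by move: vv'; rewrite /eqmod opprD.
Qed.

Lemma eqmodZ c u v : eqmod u v -> eqmod (c *: u) (c *: v).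
Proof. by rewrite /eqmod -scalerBr; apply: submodZ. Qed.

Lemma eqmod_sum (I : Type) (r : seq I) (P : pred I) (F G : I -> U) :
  (forall i, eqmod (F i) (G i)) ->
  eqmod (\sum_(i <- r | P i) F i) (\sum_(i <- r | P i) G i).
Proof.
move=> FG; apply: (big_ind2 eqmod) => //; first exact: eqmod_refl.
by move=> *; apply: eqmodD.
Qed.

Lemma submod_eqmod u v : eqmod u v -> A u <-> A v.
Proof.
move=> Auv; split=> [Au|Av]; last by rewrite -(subrK v u); apply: submodD.
by rewrite -[v](subKr u); apply: submodB.
Qed.

End Submodule.

Lemma submod_zero (R : pzRingType) (U : lmodType R) :
  submod (fun u : U => u = 0).
Proof. by split=> [|u v -> ->|c u ->]; rewrite ?addr0 ?scaler0. Qed.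

Lemma submod_full (R : pzRingType) (U : lmodType R) :
  submod (fun _ : U => True).
Proof. by constructor. Qed.

Lemma submod_preim (R : pzRingType) (U V : lmodType R) (f : {linear U -> V})
    (A : V -> Prop) : submod A -> submod (fun u => A (f u)).
Proof.
move=> sA; split=> [|u v ? ?|c u ?]; rewrite ?linear0 ?linearD ?linearZ;
  by [apply: submod0|apply: submodD|apply: submodZ].
Qed.

Section LinComb.
Variables (R : pzRingType) (U : lmodType R) (I : finType) (b : I -> U).

Definition lincomb (c : {ffun I -> R^o}) : U := \sum_i (c i : R) *: b i.

Fact lincomb_linear : linear lincomb.
Proof.
move=> a c d; rewrite /lincomb scaler_sumr -big_split /=.
by apply: eq_bigr => i _; rewrite !ffunE scalerDl scalerA.
Qed.
HB.instance Definition _ := GRing.isLinear.Build R {ffun I -> R^o} U _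
  lincomb lincomb_linear.

Lemma submod_lincomb (A : U -> Prop) c :
  submod A -> (forall i, A (b i)) -> A (lincomb c).
Proof. by move=> sA Ab; apply: submod_sum => // i; apply: submodZ. Qed.

End LinComb.

Lemma submod_rel (R : pzRingType) (U : lmodType R) (I : finType) (b : I -> U)
  (B : U -> Prop) : submod B -> submod (fun c => B (lincomb b c)).
Proof. exact: submod_preim. Qed.

Lemma linear_lincomb (R : pzRingType) (U V : lmodType R) (f : {linear U -> V})
    (I : finType) (b : I -> U) c : f (lincomb b c) = lincomb (f \o b) c.
Proof. by rewrite linear_sum; apply: eq_bigr => i _; rewrite linearZ. Qed.

Definition std (R : pzRingType) (I : finType) (i : I) : {ffun I -> R^o} :=
  [ffun j => (i == j)%:R : R].

Lemma lincomb_std (R : pzRingType) (I : finType) (c : {ffun I -> R^o}) :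
  lincomb (@std R I) c = c.
Proof.
apply/ffunP=> j; rewrite /lincomb sum_ffunE (bigD1 j) //= big1 => [|i ne_ij].
  by rewrite addr0 !ffunE eqxx [_ *: _]mulr1.
by rewrite !ffunE (negPf ne_ij) [_ *: _]mulr0.
Qed.

(** The property FP_n of the quotient A/B, unfolded along a partial resolution by
    finite free modules: after the first step everything takes place in
    submodules of finite free modules, which makes induction on n possible. *)
Fixpoint FPq (R : pzRingType) n (U : lmodType R) (A B : U -> Prop) : Prop :=
  exists (I : finType) (b : I -> U),
    [/\ forall i, A (b i),
        forall u, A u -> exists c, B (u - lincomb b c)
      & if n is n'.+1
        then FPq n' (fun c => B (lincomb b c)) (fun c => c = 0) else True].

Section Subquotient.
Variable R : pzRingType.
Implicit Types U V : lmodType R.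

Lemma eq_FPq n U (A A' B B' : U -> Prop) :
  (forall u, A u <-> A' u) -> (forall u, B u <-> B' u) ->
  FPq n A B -> FPq n A' B'.
Proof.
move=> AA' BB'.
have -> : A = A' by apply/funext=> u; apply/propext.
by have -> : B = B' by apply/funext=> u; apply/propext.
Qed.

Lemma FPq_mono n U (A B : U -> Prop) : FPq n.+1 A B -> FPq n A B.
Proof.
elim: n U A B => [|n IHn] U A B [I [b [Ab gb rb]]]; exists I, b; split=> //.
by move: rb; apply: IHn.
Qed.

Lemma FPq_trivial n U (A B : U -> Prop) :
  submod B -> (forall u, A u -> B u) -> FPq n A B.
Proof.
elim: n U A B => [|n IHn] U A B sB AB; exists void, (of_void U).
  split=> //.
  by move=> u /AB Bu; exists 0; rewrite linear0 subr0.
split=> //.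
  by move=> u /AB Bu; exists 0; rewrite linear0 subr0.
by apply: IHn (submod_zero _) _ => c _; apply/ffunP; case.
Qed.

Definition linear_mod U V (A : U -> Prop) (B : V -> Prop) (f : U -> V) :=
  forall c u v, A u -> A v -> eqmod B (f (c *: u + v)) (c *: f u + f v).

Lemma linear_mod_eq U V (A : U -> Prop) (B : V -> Prop) (f : U -> V) :
  submod B -> (forall c u v, f (c *: u + v) = c *: f u + f v) ->
  linear_mod A B f.
Proof. by move=> sB lf c u v _ _; rewrite lf; apply: eqmod_refl. Qed.

Lemma linear_mod_lincomb U V (A : U -> Prop) (B : V -> Prop) (f : U -> V)
    (I : finType) (b : I -> U) c :
  submod A -> submod B -> linear_mod A B f -> (forall i, A (b i)) ->
  eqmod B (f (lincomb b c)) (lincomb (f \o b) c).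
Proof.
move=> sA sB lf Ab; rewrite /lincomb.
elim: (index_enum I) => [|i r IHr].
  rewrite !big_nil /eqmod subr0.
  have := lf (-1) 0 0 (submod0 sA) (submod0 sA).
  by rewrite scaleN1r oppr0 addr0 scaleN1r addNr /eqmod subr0.
rewrite !big_cons; apply: (eqmod_trans sB).
  by apply: lf => //; apply: submod_sum => // j; apply: submodZ.
by apply: eqmodD => //; apply: eqmod_refl.
Qed.

(** The map on ambient modules need only be linear modulo B'. The extra room
    matters: left multiplication followed by a truncation to an L-class is
    linear only modulo the ideal below it. *)
Record subquot_iso U V (A B : U -> Prop) (A' B' : V -> Prop) (f : U -> V) :
  Prop := SubquotIso {
  iso_submod : submod A;
  iso_submod' : submod B';
  iso_linear : linear_mod A B' f;
  iso_im : forall u, A u -> A' (f u);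
  iso_ker : forall u, A u -> B u <-> B' (f u);
  iso_onto : forall v, A' v -> exists u, A u /\ eqmod B' v (f u) }.

(** Generators can be pushed forward, and pulled back by choosing preimages; in
    both cases the two families have the same module of relations. *)
Lemma FPq_iso n U V (A B : U -> Prop) (A' B' : V -> Prop) (f : U -> V) :
  subquot_iso A B A' B' f -> FPq n A B <-> FPq n A' B'.
Proof.
case=> sA sB' lf AA' BB' fsurj.
have Bf (I : finType) (b : I -> U) c : (forall i, A (b i)) ->
    B (lincomb b c) <-> B' (lincomb (f \o b) c).
  move=> Ab; apply: iff_trans (BB' _ _) _; first exact: submod_lincomb.
  exact/submod_eqmod/(linear_mod_lincomb _ sA).
have fB u v : A u -> A v -> eqmod B u v <-> eqmod B' (f u) (f v).
  move=> Au Av; apply: iff_trans (BB' _ (submodB sA Au Av)) _.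
  apply: (submod_eqmod sB'); have := lf (-1) v u Av Au.
  by rewrite !scaleN1r ![- _ + _]addrC.
have gen (I : finType) (b : I -> U) (b' : I -> V) : (forall i, A (b i)) ->
    (forall i, eqmod B' (b' i) (f (b i))) ->
    forall c u, A u -> eqmod B u (lincomb b c) <-> eqmod B' (f u) (lincomb b' c).
  move=> Ab bb' c u Au; apply: iff_trans (fB _ _ Au (submod_lincomb c sA Ab)) _.
  have E : eqmod B' (f (lincomb b c)) (lincomb b' c).
    apply: (eqmod_trans sB' (linear_mod_lincomb c sA sB' lf Ab)).
    by apply: eqmod_sum => // i; apply: eqmodZ => //; apply: eqmod_sym.
  split=> h; first exact: eqmod_trans h E.
  exact: eqmod_trans h (eqmod_sym sB' E).
have rel (I : finType) (b : I -> U) (b' : I -> V) : (forall i, A (b i)) ->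
    (forall i, eqmod B' (b' i) (f (b i))) ->
    forall c, B (lincomb b c) <-> B' (lincomb b' c).
  move=> Ab bb' c.
  have A0 := submod0 sA.
  apply: iff_trans (Bf _ _ _ Ab) _; apply: (submod_eqmod sB').
  by apply: eqmod_sum => // i; apply: eqmodZ => //; apply: eqmod_sym.
split.
  have fwd (I : finType) (b : I -> U) : (forall i, A (b i)) ->
      (forall u, A u -> exists c, B (u - lincomb b c)) ->
      forall v, A' v -> exists c, B' (v - lincomb (f \o b) c).
    move=> Ab gb v /fsurj[u [Au vu]]; have [c Bc] := gb u Au; exists c.
    apply: (eqmod_trans sB' vu).
    by apply: (proj1 (gen _ b (f \o b) Ab _ c u Au)) Bc => i; apply: eqmod_refl.
  case: n => [|n] [I [b [Ab gb rb]]]; exists I, (f \o b); split=> //.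
  - by move=> i; apply: AA'.
  - exact: fwd.
  - by move=> i; apply: AA'.
  - exact: fwd.
  apply: eq_FPq rb => // c; apply: rel => // i; exact: eqmod_refl.
have bwd (I : finType) (b' : I -> V) : (forall i, A' (b' i)) ->
    (forall v, A' v -> exists c, B' (v - lincomb b' c)) ->
    exists b : I -> U, [/\ forall i, A (b i),
       forall i, eqmod B' (b' i) (f (b i)) &
       forall u, A u -> exists c, B (u - lincomb b c)].
  move=> Ab' gb'; have /choice[b bP] i := fsurj _ (Ab' i).
  have Ab i : A (b i) by case: (bP i).
  have bb' i : eqmod B' (b' i) (f (b i)) by case: (bP i).
  exists b; split=> // u Au; have [c] := gb' _ (AA' u Au); exists c.
  by apply/(gen _ b b').
case: n => [|n] [I [b' [/bwd{}bwd /bwd[b [Ab bb' gb]] rb]]]; exists I, b.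
  by split.
by split=> //; apply: eq_FPq rb => // c; split=> /(rel _ b b' Ab bb').
Qed.

Lemma FPq_push n U V (A B : U -> Prop) (A' B' : V -> Prop) (f : U -> V) :
  subquot_iso A B A' B' f -> FPq n A B -> FPq n A' B'.
Proof. by move/(FPq_iso n) => []. Qed.

Lemma FPq_pull n U V (A B : U -> Prop) (A' B' : V -> Prop) (f : U -> V) :
  subquot_iso A B A' B' f -> FPq n A' B' -> FPq n A B.
Proof. by move/(FPq_iso n) => []. Qed.

(** Extensions: generators of B/C together with lifts of generators of A/B
    generate A/C, and the relations between them are again an extension. *)
Lemma FPq_ext n U (A B C : U -> Prop) :
  submod A -> submod B -> submod C ->
  (forall u, B u -> A u) -> (forall u, C u -> B u) ->
  FPq n B C -> FPq n A B -> FPq n A C.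
Proof.
elim: n U A B C => [|n IHn] U A B C sA sB sC BA CB;
  move=> [I [b [Bb gb rb]]] [J [a [Aa ga ra]]];
  pose h (k : I + J) := match k with inl i => b i | inr j => a j end;
  have hE (c : {ffun (I + J)%type -> R^o}) : lincomb h c =
      lincomb b [ffun i => c (inl i)] + lincomb a [ffun j => c (inr j)]
    by rewrite /lincomb big_sumType; congr (_ + _);
       apply: eq_bigr => k _; rewrite ffunE.
- exists (I + J)%type, h; split=> // [[i|j]|u /ga[d /gb[c Cc]]] //=.
    exact/BA.
  exists [ffun k => match k with inl i => c i | inr j => d j end].
  rewrite hE opprD [- _ - _]addrC addrA.
  congr C: Cc; congr (_ - lincomb a _ - lincomb b _); by apply/ffunP=> i; rewrite !ffunE.
exists (I + J)%type, h; split=> [[i|j]|u /ga[d /gb[c Cc]]|] //=.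
- exact/BA.
- exists [ffun k => match k with inl i => c i | inr j => d j end].
  rewrite hE opprD [- _ - _]addrC addrA.
  congr C: Cc; congr (_ - lincomb a _ - lincomb b _); by apply/ffunP=> i; rewrite !ffunE.
(* The relations N of the joint family contain those of b alone, as N1; the
   quotient N/N1 is the relation module of a modulo B. *)
pose N c := C (lincomb h c); pose N1 c := N c /\ forall j : J, c (inr j) = 0.
have sN : submod N by apply: submod_rel.
have sN1 : submod N1.
  split=> [|u v [Nu u0] [Nv v0]|c u [Nu u0]]; split; try by move=> j; rewrite !ffunE.
  - exact: submod0.
  - exact: submodD.
  - by move=> j; rewrite ffunE u0 v0 addr0.
  - exact: submodZ.
  - by move=> j; rewrite ffunE u0 scaler0.
have s0 (I' : finType) := @submod_zero R {ffun I' -> R^o}.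
apply: (IHn _ N N1 _ sN sN1 (s0 _)) => [c []//|c ->||].
- by split=> [|j]; [apply: submod0|rewrite ffunE].
- pose f (c : {ffun I -> R^o}) : {ffun (I + J)%type -> R^o} :=
    [ffun k => if k is inl i then c i else 0].
  have fE c : lincomb h (f c) = lincomb b c.
    rewrite hE [X in _ + X](_ : _ = 0).
      by rewrite addr0; congr lincomb; apply/ffunP=> i; rewrite !ffunE.
    by rewrite -(linear0 (lincomb a)); congr lincomb; apply/ffunP=> i; rewrite !ffunE.
  apply: (FPq_push (f := f)) rb; split=> // [||c u v _ _|c Cc|c Cc|c [Nc c0]].
  + exact: submod_rel.
  + exact: s0.
  + apply/(eqmod_eq (s0 _))/ffunP=> -[i|j]; rewrite !ffunE //.
    by rewrite scaler0 addr0.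
  + by split=> [|j]; rewrite ?/N ?fE ?ffunE.
  + split=> [->|/ffunP fc0]; first by apply/ffunP=> -[i|j]; rewrite !ffunE.
    by apply/ffunP=> i; have := fc0 (inl i); rewrite !ffunE.
  have cE : c = f [ffun i => c (inl i)].
    by apply/ffunP=> -[i|j]; rewrite !ffunE ?c0.
  exists [ffun i => c (inl i)]; rewrite -cE; split; last exact: (eqmod_refl (s0 _)).
  by rewrite -fE -cE.
pose f (c : {ffun (I + J)%type -> R^o}) : {ffun J -> R^o} := [ffun j => c (inr j)].
apply: (FPq_pull (f := f)) ra; split=> // [|c u v _ _|c Cc|c Cc|c Bc].
- exact: s0.
- by apply/(eqmod_eq (s0 _))/ffunP=> j; rewrite !ffunE.
- suff: B (lincomb b [ffun i => c (inl i)] + lincomb a (f c)).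
    by move/(submodB sB)/(_ (submod_lincomb [ffun i => c (inl i)] sB Bb)); 
      rewrite addrAC subrr add0r.
  by apply: CB; move: Cc; rewrite /N hE.
- split=> [[_ c0]|/ffunP c0]; first by apply/ffunP=> j; rewrite !ffunE.
  by split=> // j; have := c0 j; rewrite !ffunE.
have [d Cd] := gb _ Bc.
exists [ffun k => match k with inl i => - d i | inr j => c j end]; split; last first.
  by apply/(eqmod_eq (s0 _))/ffunP=> j; rewrite !ffunE.
rewrite /N hE; congr C: Cd; rewrite addrC; congr (_ + _).
  by rewrite -linearN; congr lincomb; apply/ffunP=> j; rewrite !ffunE.
by congr lincomb; apply/ffunP=> j; rewrite !ffunE.
Qed.

(** The same generators serve for A/C and A/B; their relations modulo B form an
    extension of B/C by their relations modulo C. *)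
Lemma FPq_quot n U (A B C : U -> Prop) :
  submod A -> submod B -> submod C ->
  (forall u, B u -> A u) -> (forall u, C u -> B u) ->
  FPq n A C -> (forall m, n = m.+1 -> FPq m B C) -> FPq n A B.
Proof.
move=> sA sB sC BA CB; case: n => [|n] [I [a [Aa ga ra]]] BC; exists I, a.
  by split=> // u /ga[c /CB]; exists c.
split=> //; first by move=> u /ga[c /CB]; exists c.
have sNB : submod (fun c => B (lincomb a c)) by apply: submod_rel.
have sNC : submod (fun c => C (lincomb a c)) by apply: submod_rel.
apply: FPq_ext ra _ => //; [exact: submod_zero|by move=> c /CB|
  by move=> c ->; rewrite linear0; apply: submod0|].
apply: (FPq_pull (f := lincomb a)) (BC n erefl); split=> //.
  by apply: linear_mod_eq => // *; rewrite linearP.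
by move=> u Bu; have [c Cc] := ga u (BA u Bu); exists c; split=> //;
  apply/(submod_eqmod sB (CB _ Cc)).
Qed.

(** A retract of a finite free module is FP_n for every n: the relations are
    the kernel of an idempotent of the free module, again a retract. *)
Lemma FPq_retract n U (A : U -> Prop) (I : finType)
    (b : {linear {ffun I -> R^o} -> U}) (h : {linear U -> {ffun I -> R^o}}) :
  submod A ->
  (forall c, A (b c)) -> (forall u, A u -> b (h u) = u) ->
  FPq n A (fun u => u = 0).
Proof.
elim: n U A b h => [|n IHn] U A b h sA Ab bh.
  exists I, (b \o @std R I); split=> // [i|u Au]; first exact: Ab.
  by exists (h u); rewrite -linear_lincomb lincomb_std bh ?subrr.
exists I, (b \o @std R I); split=> // [i|u Au|]; first exact: Ab.
  by exists (h u); rewrite -linear_lincomb lincomb_std bh ?subrr.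
have lq : linear (fun c => c - h (b c)).
  by move=> k c d; rewrite [b _]linearP [h _]linearP opprD addrACA scalerBr.
pose qM := GRing.isLinear.Build R _ _ _ _ lq.
pose q : {linear {ffun I -> R^o} -> {ffun I -> R^o}} :=
  HB.pack (fun c => c - h (b c)) qM.
apply: (IHn _ _ q idfun) => [|c|c /=].
- by apply: submod_preim (submod_zero _).
- by rewrite -linear_lincomb lincomb_std linearB /= bh ?subrr.
by rewrite -linear_lincomb lincomb_std => ->; rewrite linear0 subr0.
Qed.

End Subquotient.

(** * Projective resolutions *)

Notation FPqT n U := (FPq n (fun _ : U => True) (fun u : U => u = 0)).

(** Projectivity makes a finitely generated module a retract of a free one. *)
Lemma projective_FPq (R : pzRingType) (P : lmodType R) n :
  projective P -> finitely_generated P -> FPqT n P.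
Proof.
move=> projP [k [b gb]].
have [|h bh] := projP _ P (lincomb b) idfun.
  by move=> u; have [c ->] := gb u; exists [ffun i => c i];
     apply: eq_bigr => i _; rewrite ffunE.
by apply: (FPq_retract n (b := lincomb b) (h := h)) => // u _; apply: bh.
Qed.

(** In a resolution the i-th syzygy is the (i+1)-st module modulo the (i+1)-st
    syzygy, so finiteness climbs down from the last finitely generated
    module. *)
Lemma resolution_FPq (R : pzRingType) (M : lmodType R) n
    (P : nat -> lmodType R) (d : forall i, {linear P i.+1 -> P i})
    (eps : {linear P 0%N -> M}) :
  (forall i, projective (P i)) ->
  (forall i, (i <= n)%N -> finitely_generated (P i)) ->
  surjective eps -> exact_at (d 0%N) eps ->
  (forall i, exact_at (d i.+1) (d i)) ->
  FPqT n M.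
Proof.
move=> projP fgP eps_onto ex0 exS.
have image_FPq (N : lmodType R) i (f : {linear P i -> N}) m : (i <= n)%N ->
    (forall m', m = m'.+1 -> FPq m' (fun u => f u = 0) (fun u => u = 0)) ->
    FPq m (fun v => exists u, f u = v) (fun v => v = 0).
  move=> le_in kerf.
  have sK : submod (fun u => f u = 0) by apply: submod_preim (submod_zero _).
  have sT := submod_full (P i); have s0 := @submod_zero R.
  apply: (@FPq_push _ _ _ _ (fun _ => True) (fun u => f u = 0) _ _ f).
    split=> // [|u _|_ [u <-]].
    - by apply: linear_mod_eq (s0 _) _ => *; rewrite linearP.
    - by exists u.
    by exists u; split=> //; apply: eqmod_refl (s0 _) _.
  apply: (FPq_quot sT sK (s0 _)) => // [u ->|]; first exact: linear0.
  by apply: projective_FPq => //; apply: fgP.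
have ker_im i m : (m + i < n)%N ->
    FPq m (fun v => exists u, d i u = v) (fun v => v = 0).
  elim: m i => [|m IHm] i lt_n; apply: image_FPq => // [|m' [<-{m'}]].
    by apply: leq_ltn_trans lt_n; apply: leq_addl.
  apply: eq_FPq (IHm i.+1 _) => // [v|]; last by rewrite addnS.
  exact: iff_sym (exS i v).
apply: eq_FPq (image_FPq _ 0%N eps n _ _) => // m n_eq.
apply: eq_FPq (ker_im 0%N m _) => // [v|]; last by rewrite n_eq addn0.
exact: iff_sym (ex0 v).
Qed.

Lemma FP_FPq n (S : monoidType) : FP n S -> FPqT n (trivial_module S).
Proof. by case=> P [d [eps [? ? ? ? ?]]]; apply: (@resolution_FPq _ _ _ P d eps). Qed.

Lemma ffun_projective (R : pzRingType) (I : finType) :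
  projective {ffun I -> R^o}.
Proof.
move=> M N g f g_onto; have /choice[m mP] i := g_onto (f (std R i)).
exists (lincomb m) => c; rewrite linear_lincomb.
rewrite -[in RHS](lincomb_std c) [RHS]linear_lincomb.
by apply: eq_bigr => i _ /=; rewrite mP.
Qed.

Section FreeModule.
Variables (R : nzRingType) (K : choiceType) (M : lmodType R) (m : K -> M).

Definition malg_lift (x : {malg R[K]}) : M := \sum_(k <- msupp x) x@_k *: m k.

Lemma malg_liftw (d : {fset K}) x : (msupp x `<=` d)%fset ->
  malg_lift x = \sum_(k <- d) x@_k *: m k.
Proof.
by move=> le_d; apply/big_fset_incl => // k _ /mcoeff_outdom ->; rewrite scale0r.
Qed.

Fact malg_lift_linear : linear malg_lift.
Proof.
move=> c x y; pose d := (msupp (c *: x + y) `|` (msupp x `|` msupp y))%fset.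
rewrite [LHS](malg_liftw (d := d)) ?fsubsetUl //.
rewrite (malg_liftw (d := d) (x := x)); last first.
  by apply: fsubset_trans (fsubsetUr _ _); apply: fsubsetUl.
rewrite (malg_liftw (d := d) (x := y)); last first.
  by apply: fsubset_trans (fsubsetUr _ _); apply: fsubsetUr.
rewrite scaler_sumr -big_split /=; apply: eq_bigr => k _.
by rewrite mcoeffD mcoeffZ scalerDl scalerA.
Qed.
HB.instance Definition _ := GRing.isLinear.Build R {malg R[K]} M _
  malg_lift malg_lift_linear.

Lemma malg_liftU k : malg_lift (mkmalgU k 1) = m k.
Proof. by rewrite (malg_liftw msuppU_le) big_seq_fset1 mcoeffUU scale1r. Qed.

End FreeModule.

Lemma malg_projective (R : nzRingType) (K : choiceType) :
  projective ({malg R[K]} : lmodType R).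
Proof.
move=> M N g f g_onto.
have /choice[m mP] k := g_onto (f (mkmalgU k 1)).
exists (malg_lift m) => x; rewrite linear_sum.
rewrite [in RHS](monalgE x) linear_sum; apply: eq_bigr => k _.
rewrite linearZ /= mP -linearZ /=; congr (f _); apply/malgP=> l.
by rewrite mcoeffZ !mcoeffU; case: eqP; rewrite ?mulr1 ?mulr0.
Qed.

Section Resolution.
Variable R : nzRingType.

(** The index is shifted by one, so that index 0 carries no condition; it is
    reached beyond the finitely generated part of the resolution. *)
Definition FPpred j (U : lmodType R) (A : U -> Prop) : Prop :=
  if j is j'.+1 then FPq j' A (fun u => u = 0) else True.

(** A stage of the construction of a resolution: the module that the next map
    has to cover. *)
Record submodule := Submodule {
  ambient : lmodType R; carrier :> ambient -> Prop; _ : submod carrier }.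

Record cover j (X : submodule) := Cover {
  cover_mod : lmodType R;
  cover_map : {linear cover_mod -> ambient X};
  cover_projective : projective cover_mod;
  cover_im : forall u, X u <-> exists p, cover_map p = u;
  cover_fg : FPpred j X -> (0 < j)%N -> finitely_generated cover_mod;
  cover_ker : FPpred j X -> FPpred j.-1 (fun p => cover_map p = 0) }.

(** While finitely many generators are available the cover is finite free;
    otherwise the free module on the set of all elements is used. *)
Lemma cover_exists j X : exists _ : cover j X, True.
Proof.
have sX : submod X by case: (X).
have [FPX|nFPX] := pselect ((0 < j)%N /\ FPpred j X); last first.
  pose m (u : {u : ambient X | `[< X u >]}) := val u.
  unshelve eexists (@Cover _ _ {malg R[_]} (malg_lift m) _ _ _ _) => //.
  - exact: malg_projective.
  - move=> u; split=> [Xu|[p <-]].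
      by exists (mkmalgU (exist _ u (asboolT Xu)) 1); rewrite /= malg_liftU.
    by apply: submod_sum => // k; apply: submodZ => //; apply/asboolP/(valP k).
  - by move=> FPX lt0j; case: nFPX.
  - by move=> FPX; case: j FPX nFPX => // j FPX [].
case: FPX; case: j => // j _ /= FPX.
have [I [b [Xb gb rb]]] : exists (I : finType) (b : I -> ambient X),
    [/\ forall i, X (b i), forall u, X u -> exists c, u = lincomb b c
      & FPpred j (fun c => lincomb b c = 0)].
  by case: j FPX => [|j] [I [b [Xb gb rb]]]; exists I, b; split=> // u /gb[c /eqP];
     rewrite subr_eq0 => /eqP ->; exists c.
unshelve eexists (@Cover _ _ {ffun I -> R^o} (lincomb b) _ _ _ _) => //.
- exact: ffun_projective.
- move=> u; split=> [/gb[c ->]|[c <-]]; first by exists c.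
  exact: submod_lincomb.
move=> _ _; exists #|I|, (fun i => std R (enum_val i)) => c.
exists (fun i => c (enum_val i)); rewrite -[LHS]lincomb_std /lincomb.
by rewrite (reindex_onto enum_val enum_rank) => [|i _]; rewrite ?enum_rankK //=;
  apply: eq_bigl => i; rewrite enum_valK eqxx.
Qed.

Definition a_cover j X : cover j X := sval (cid (cover_exists j X)).

Definition kernel (U V : lmodType R) (f : {linear U -> V}) : submodule :=
  @Submodule U (fun u => f u = 0) (submod_preim f (submod_zero V)).

Variables (M : lmodType R) (n : nat).

Fixpoint syzygy i : submodule :=
  if i is i'.+1 then kernel (cover_map (a_cover (n.+1 - i') (syzygy i')))
  else Submodule (submod_full M).

Definition resol i : lmodType R := ambient (syzygy i.+1).

Definition resol_map i : {linear resol i -> ambient (syzygy i)} :=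
  cover_map (a_cover (n.+1 - i) (syzygy i)).

Lemma FPq_resolution : FPqT n M ->
  [/\ forall i, projective (resol i),
      forall i, (i <= n)%N -> finitely_generated (resol i),
      surjective (resol_map 0),
      exact_at (resol_map 1) (resol_map 0)
    & forall i, exact_at (resol_map i.+2) (resol_map i.+1)].
Proof.
move=> FPM.
have FPs i : FPpred (n.+1 - i) (syzygy i).
  elim: i => [|i IHi] //=; rewrite subnS; exact: cover_ker.
have im k u : syzygy k u <-> exists p, resol_map k p = u.
  exact: (cover_im (a_cover (n.+1 - k) (syzygy k))).
split=> [i|i le_in|u|u|i u].
- exact: cover_projective.
- by apply: (cover_fg _ (FPs i)); rewrite subn_gt0.
- by apply/(im 0%N).
- exact: (im 1%N u).
exact: (im i.+2 u).
Qed.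

End Resolution.

Lemma FPq_FP n (S : monoidType) : FPqT n (trivial_module S) -> FP n S.
Proof.
case/FPq_resolution => proj fg onto ex0 exS.
exists (resol (trivial_module S) n).
exists (fun i => resol_map (trivial_module S) n i.+1).
by exists (resol_map (trivial_module S) n 0).
Qed.

(** * Modules over monoid rings *)

Section MonoidRingModules.
Variable S : monoidType.
Local Notation ZS := (monoid_ring S).

Definition mr (s : S) : ZS := mkmalgU s 1.

Lemma mrM s t : mr s * mr t = mr (s * t)%g.
Proof. by rewrite [LHS]mr_mulUU mulr1. Qed.

Lemma mr_1 : mr 1%g = 1. Proof. by []. Qed.

Lemma mkmalgU_mr (k : S) (c : int) : mkmalgU k c = mr k *~ c.
Proof.
apply/malgP=> l; rewrite raddfMz /= !mcoeffU.
by case: eqP => _; rewrite ?mulr1n ?intz // mulr0n mul0rz.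
Qed.

(** The additive subgroup Z[P] spanned by P, as a condition on supports. *)
Definition zspan (P : S -> Prop) (u : ZS) := forall k, u@_k != 0 -> P k.

(** To check a property closed under differences it is enough to look at basis
    elements; coefficients never need to be handled. *)
Lemma zspan_ind (P : S -> Prop) (T : ZS -> Prop) :
  T 0 -> (forall u v, T u -> T v -> T (u - v)) ->
  (forall k, P k -> T (mr k)) -> forall u, zspan P u -> T u.
Proof.
move=> T0 TB TP u Pu.
have TN v : T v -> T (- v) by move=> Tv; rewrite -sub0r; apply: TB.
have TD v w : T v -> T w -> T (v + w).
  by move=> Tv /TN Tw; rewrite -[w]opprK; apply: TB.
have TM v (n : nat) : T v -> T (v *+ n).
  by move=> Tv; elim: n => [|n IHn]; rewrite ?mulr0n // mulrS; apply: TD.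
rewrite [u]monalgE big_seq; apply: big_ind => // k; rewrite -mcoeff_neq0 => /Pu Pk.
rewrite mkmalgU_mr; case: (u@_k) => n; first by apply: TM; apply: TP.
by rewrite NegzE mulrNz; apply: TN; apply: TM; apply: TP.
Qed.

Lemma mr_ind (T : ZS -> Prop) :
  T 0 -> (forall u v, T u -> T v -> T (u - v)) ->
  (forall k, T (mr k)) -> forall u, T u.
Proof. by move=> T0 TB Tk u; apply: (zspan_ind (P := fun _ => True)). Qed.

Lemma zspan0 P : zspan P 0.
Proof. by move=> k; rewrite mcoeff0 eqxx. Qed.

Lemma zspanB P u v : zspan P u -> zspan P v -> zspan P (u - v).
Proof.
move=> Pu Pv k; rewrite mcoeffB => nz; have [u0|/Pu//] := eqVneq u@_k 0.
by apply: Pv; move: nz; rewrite u0 sub0r oppr_eq0.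
Qed.

Lemma zspanU (P : S -> Prop) k : P k -> zspan P (mr k).
Proof.
move=> Pk l; rewrite mcoeffU.
by case: (k =P l) => [<- //|_]; rewrite mulr0n eqxx.
Qed.

Lemma zspanD P u v : zspan P u -> zspan P v -> zspan P (u + v).
Proof.
move=> Pu Pv; rewrite -[v]opprK; apply: zspanB => //.
by rewrite -sub0r; apply: zspanB => //; apply: zspan0.
Qed.

Lemma zspanS (P Q : S -> Prop) u :
  (forall k, P k -> Q k) -> zspan P u -> zspan Q u.
Proof. by move=> PQ Pu k /Pu /PQ. Qed.

Section Lift.
Variables (X : zmodType) (f : S -> X).

Definition mlift (c : ZS) : X := \sum_(k <- msupp c) f k *~ c@_k.

Lemma mliftw (d : {fset S}) c : (msupp c `<=` d)%fset ->
  mlift c = \sum_(k <- d) f k *~ c@_k.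
Proof.
by move=> le_d; apply/big_fset_incl => // k _ /mcoeff_outdom ->; rewrite mulr0z.
Qed.

Lemma mliftD c1 c2 : mlift (c1 + c2) = mlift c1 + mlift c2.
Proof.
pose d := (msupp c1 `|` msupp c2)%fset.
rewrite (mliftw (d := d)) ?msuppD_le //.
rewrite (mliftw (d := d) (c := c1)) ?fsubsetUl //.
rewrite (mliftw (d := d) (c := c2)) ?fsubsetUr //.
by rewrite -big_split; apply: eq_bigr => k _; rewrite mcoeffD mulrzDr.
Qed.

Lemma mlift0 : mlift 0 = 0.
Proof. by rewrite /mlift msupp0 big_seq_fset0. Qed.

Lemma mliftB c1 c2 : mlift (c1 - c2) = mlift c1 - mlift c2.
Proof. by apply: (addIr (mlift c2)); rewrite -mliftD !subrK. Qed.

Lemma mliftU s z : mlift (mkmalgU s z) = f s *~ z.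
Proof. by rewrite (mliftw msuppU_le) big_seq_fset1 mcoeffUU. Qed.

Lemma mlift_mr s : mlift (mr s) = f s.
Proof. exact: mliftU. Qed.

End Lift.

Section Generators.
Variables (U : lmodType ZS).

Lemma submod_mr (A : U -> Prop) :
  A 0 -> (forall u v, A u -> A v -> A (u - v)) ->
  (forall s u, A u -> A (mr s *: u)) -> submod A.
Proof.
move=> A0 AB As; split=> // [u v Au Av|c u Au].
  by rewrite -[v]opprK -[- v]sub0r; apply: (AB) => //; apply: AB.
elim/mr_ind: c => [|c d Ac Ad|s]; [by rewrite scale0r| |exact: As].
by rewrite scalerBl; apply: AB.
Qed.

Lemma linear_mod_mr (V : lmodType ZS) (A : U -> Prop) (B : V -> Prop)
    (f : U -> V) :
  submod A -> submod B -> (forall u v, f (u + v) = f u + f v) ->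
  (forall s u, A u -> eqmod B (f (mr s *: u)) (mr s *: f u)) ->
  linear_mod A B f.
Proof.
move=> sA sB fD fs c u v Au Av; rewrite fD.
apply: eqmodD (eqmod_refl sB _) => //.
have f0 : f 0 = 0 by apply: (addIr (f 0)); rewrite -fD !add0r.
have fB x y : f (x - y) = f x - f y by apply: (addIr (f y)); rewrite -fD !subrK.
elim/mr_ind: c => [|c d Ac Ad|s]; last exact: fs.
  by rewrite !scale0r f0; apply: eqmod_refl.
by rewrite !scalerBl fB; apply: eqmodB.
Qed.

End Generators.

(** An action of S by endomorphisms of an abelian group is a module structure
    over the monoid ring. *)
Record madd_action (X : zmodType) := MaddAction {
  act :> S -> X -> X;
  act1 : forall x, act 1%g x = x;
  actM : forall s t x, act (s * t)%g x = act s (act t x);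
  actD : forall s x y, act s (x + y) = act s x + act s y }.

Section ActionModule.
Variables (X : zmodType) (a : madd_action X).

Definition action_module of madd_action X := (X : Type).
Local Notation M := (action_module a).
HB.instance Definition _ := GRing.Zmodule.on M.

Definition action_scale (c : ZS) (x : M) : M := mlift (a^~ x) c.

Lemma action_scale_mr s x : action_scale (mr s) x = a s x.
Proof. exact: mlift_mr. Qed.

Fact action_scaleDl x : {morph action_scale^~ x : c d / c + d}.
Proof. by move=> c d; apply: mliftD. Qed.

Fact action_scaleDr : right_distributive action_scale +%R.
Proof.
move=> c x y; elim/mr_ind: c => [|c d IHc IHd|s].
- by rewrite /action_scale !mlift0 addr0.
- by rewrite /action_scale !mliftB [mlift _ c]IHc [mlift _ d]IHd opprD addrACA.
by rewrite !action_scale_mr actD.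
Qed.

Fact action_scaleA c d x :
  action_scale c (action_scale d x) = action_scale (c * d) x.
Proof.
elim/mr_ind: c => [|c1 c2 IH1 IH2|s].
- by rewrite mul0r /action_scale !mlift0.
- by rewrite mulrBl /action_scale !mliftB; congr (_ - _).
elim/mr_ind: d => [|d1 d2 IH1 IH2|t].
- rewrite mulr0 /action_scale !mlift0 mlift_mr.
  by apply: (addIr (a s 0)); rewrite -actD !add0r.
- rewrite mulrBr /action_scale !mliftB -[mlift _ (mr s * d1)]IH1.
  rewrite -[mlift _ (mr s * d2)]IH2.
  apply: (addIr (action_scale (mr s) (action_scale d2 x))).
  by rewrite subrK -action_scaleDr subrK.
by rewrite mrM !action_scale_mr actM.
Qed.

Fact action_scale1 : left_id 1 action_scale.
Proof. by move=> x; rewrite -mr_1 action_scale_mr act1. Qed.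

HB.instance Definition _ := GRing.Zmodule_isLmodule.Build ZS M
  action_scaleA action_scale1 action_scaleDr action_scaleDl.

Lemma scale_mr s (x : M) : mr s *: x = a s x.
Proof. exact: action_scale_mr. Qed.

End ActionModule.

End MonoidRingModules.

(** * Induced modules *)

Lemma linear_mr (S : monoidType) (U V : lmodType (monoid_ring S)) (f : U -> V) :
  (forall u v, f (u + v) = f u + f v) ->
  (forall s u, f (mr s *: u) = mr s *: f u) ->
  forall c u v, f (c *: u + v) = c *: f u + f v.
Proof.
move=> fD fs c u v; apply/eqP; rewrite -subr_eq0; apply/eqP.
apply: (@linear_mod_mr _ _ _ (fun _ => True) (fun v => v = 0)) => //.
  exact: submod_zero.
by move=> s w _; rewrite fs; apply: eqmod_refl (submod_zero _) _.
Qed.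

Section Evaluation.
Variables (R : pzRingType) (J : finType) (j : J).
Definition ffun_eval (c : {ffun J -> R^o}) : R^o := c j.
Fact ffun_eval_linear : linear ffun_eval.
Proof. by move=> c u v; rewrite /ffun_eval !ffunE. Qed.
HB.instance Definition _ := GRing.isLinear.Build R {ffun J -> R^o} R^o _
  ffun_eval ffun_eval_linear.
End Evaluation.

Section Induction.
Variables (S : monoidType) (R : pzRingType) (I : finType).

(** A representation of S by matrices over R makes R^I a bimodule, with S
    acting on the left and R on the right; the module induced from X is the
    tensor product of this bimodule with X, that is X^I. *)
Record mxrep := MxRep {
  mxr :> S -> I -> I -> R;
  mxr1 : forall i j, mxr 1%g i j = (i == j)%:R;
  mxrM : forall s t i j, mxr (s * t)%g i j = \sum_l mxr s i l * mxr t l j }.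

Variable rho : mxrep.

Section Module.
Variable X : lmodType R.

Definition mx_act s (x : {ffun I -> X}) : {ffun I -> X} :=
  [ffun i => \sum_j rho s i j *: x j].

Fact mx_act1 x : mx_act 1%g x = x.
Proof.
apply/ffunP=> i; rewrite ffunE (bigD1 i) //= mxr1 eqxx scale1r big1 ?addr0 //.
by move=> j ne_ji; rewrite mxr1 eq_sym (negPf ne_ji) scale0r.
Qed.

Fact mx_actM s t x : mx_act (s * t)%g x = mx_act s (mx_act t x).
Proof.
apply/ffunP=> i; rewrite !ffunE.
under [RHS]eq_bigr do rewrite ffunE scaler_sumr.
rewrite exchange_big; apply: eq_bigr => j _; rewrite mxrM scaler_suml.
by apply: eq_bigr => l _; rewrite scalerA.
Qed.

Fact mx_actD s x y : mx_act s (x + y) = mx_act s x + mx_act s y.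
Proof.
apply/ffunP=> i; rewrite !ffunE -big_split; apply: eq_bigr => j _.
by rewrite ffunE scalerDr.
Qed.

Definition mx_action : madd_action S {ffun I -> X} :=
  MaddAction mx_act1 mx_actM mx_actD.

Definition induced : lmodType (monoid_ring S) := action_module mx_action.

Definition coef (x : induced) : I -> X := fun i => (x : {ffun I -> X}) i.

Definition of_coef (f : I -> X) : induced := [ffun i => f i].

Lemma of_coefE f i : coef (of_coef f) i = f i. Proof. exact: ffunE. Qed.

Lemma coefP (x y : induced) : (forall i, coef x i = coef y i) <-> x = y.
Proof. by split=> [xy|->//]; apply/ffunP. Qed.

Lemma coefD x y i : coef (x + y) i = coef x i + coef y i.
Proof. exact: ffunE. Qed.

Lemma coefB x y i : coef (x - y) i = coef x i - coef y i.
Proof. by rewrite /coef !ffunE. Qed.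

Lemma coef0 i : coef 0 i = 0. Proof. exact: ffunE. Qed.

Lemma coef_sum (J : finType) (F : J -> induced) i :
  coef (\sum_j F j) i = \sum_j coef (F j) i.
Proof. exact: (big_morph (coef^~ i) (fun x y => coefD x y i) (coef0 i)). Qed.

Lemma coefMz (x : induced) z i : coef (x *~ z) i = coef x i *~ z.
Proof. exact: ffunMzE. Qed.

Lemma coef_scale s (x : induced) i :
  coef (mr s *: x) i = \sum_j rho s i j *: coef x j.
Proof. by rewrite [mr s *: x]scale_mr /= /mx_act /coef ffunE. Qed.

Definition ind (A : X -> Prop) (x : induced) := forall i, A (coef x i).

Lemma submod_ind A : submod A -> submod (ind A).
Proof.
move=> sA; apply: submod_mr => [i|u v Au Av i|s u Au i].
- by rewrite coef0; apply: submod0.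
- by rewrite coefB; apply: submodB.
by rewrite coef_scale; apply: submod_sum => // j; apply: submodZ => //; apply: Au.
Qed.

Lemma ind0 x : ind (fun u => u = 0) x <-> x = 0.
Proof.
split=> [x0|->] => [|i]; last exact: coef0.
by apply/coefP => i; rewrite x0 coef0.
Qed.

End Module.

Definition ind_map (X Y : lmodType R) (f : X -> Y) (x : induced X) : induced Y :=
  of_coef (f \o coef x).

Lemma ind_map_linear (X Y : lmodType R) (f : {linear X -> Y}) c u v :
  ind_map f (c *: u + v) = c *: ind_map f u + ind_map f v.
Proof.
apply: linear_mr => {u v} [u v|s u]; apply/coefP=> i.
  by rewrite coefD !of_coefE /= coefD linearD.
rewrite coef_scale of_coefE /= coef_scale linear_sum; apply: eq_bigr => j _.
by rewrite linearZ of_coefE.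
Qed.

(** Filtration of R^J by the number of coordinates allowed to be nonzero. *)
Lemma induced_free_FPq n (J : finType) :
  FPqT n (induced R^o) -> FPqT n (induced {ffun J -> R^o}).
Proof.
move=> FPR; pose A (r : seq J) (x : induced {ffun J -> R^o}) :=
  forall i j, j \notin r -> coef x i j = 0.
have sA r : submod (A r).
  have -> : A r = ind (fun c : {ffun J -> R^o} => forall j, j \notin r -> c j = 0).
    by [].
  apply: submod_ind; split=> [j|u v u0 v0 j jr|c u u0 j jr]; rewrite ffunE //.
    by rewrite u0 ?v0 ?addr0.
  by rewrite u0 ?scaler0.
have s0 := submod_zero (induced {ffun J -> R^o}).
suff FPr r : uniq r -> FPq n (A r) (fun x => x = 0).
  apply: eq_FPq (FPr (enum J) (enum_uniq _)) => // x.
  by split=> // _ i j; rewrite mem_enum.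
elim: r => [_|j r IHr /= /andP[jr /IHr{}IHr]].
  apply: FPq_trivial => // x Ax; apply/coefP=> i; apply/ffunP=> j.
  by rewrite Ax // coef0 ffunE.
apply: (FPq_ext (sA _) (sA r) s0) => // [x Ax i k|x ->|].
- by rewrite inE => /norP[_ /Ax].
- exact: submod0.
apply: (FPq_pull (f := ind_map (@ffun_eval R J j))) FPR; split=> // [||x Ax|y _].
- exact: submod_zero.
- apply: linear_mod_eq (submod_zero _) _; apply: ind_map_linear.
- split=> [Ax0|x0 i k].
    by apply/coefP=> i; rewrite of_coefE /= /ffun_eval Ax0 // coef0.
  have [-> _|ne_kj kr] := eqVneq k j; last by rewrite Ax // inE negb_or ne_kj.
  by move/coefP/(_ i): x0; rewrite of_coefE coef0.
exists (of_coef (fun i => [ffun k => if k == j then coef y i else 0])).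
split=> [i k|].
  by rewrite inE => /norP[/negPf nkj _]; rewrite of_coefE ffunE nkj.
apply/(eqmod_eq (submod_zero _))/coefP=> i.
by rewrite of_coefE /= /ffun_eval of_coefE ffunE eqxx.
Qed.

(** Induction is componentwise, hence exact; as it sends R to an FP_n module, it
    carries a partial free resolution to a partial resolution by FP_n
    modules. *)
Lemma induced_FPq n (X : lmodType R) (A B : X -> Prop) :
  FPqT n (induced R^o) -> submod A -> submod B ->
  FPq n A B -> FPq n (ind A) (ind B).
Proof.
move=> + sA sB.
have step m (X' : lmodType R) (A' B' : X' -> Prop) (J : finType) (b : J -> X') :
    submod A' -> submod B' -> FPqT m (induced R^o) ->
    (forall j, A' (b j)) ->
    (forall u, A' u -> exists c, B' (u - lincomb b c)) ->
    (forall m', m = m'.+1 ->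
       FPq m' (ind (fun c => B' (lincomb b c))) (fun x => x = 0)) ->
    FPq m (ind A') (ind B').
  move=> sA' sB' FPR Ab gb FPrel.
  apply: (FPq_push (f := ind_map (lincomb b)) (A := fun _ => True)
    (B := ind (fun c => B' (lincomb b c)))).
    split=> // [||u _ i|u _|v Av].
    - exact: submod_ind.
    - apply: linear_mod_eq (submod_ind sB') _; apply: ind_map_linear.
    - by rewrite of_coefE; apply: submod_lincomb.
    - by split=> Bu i; have := Bu i; rewrite of_coefE.
    have /choice[c Bc] i := gb _ (Av i).
    exists (of_coef c); split=> // i.
    by rewrite coefB !of_coefE /= of_coefE; apply: Bc.
  have s0 := submod_zero (induced {ffun J -> R^o}).
  apply: (FPq_quot (submod_full _) _ s0) => // [|x ->|].
  - exact/submod_ind/submod_rel.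
  - by move=> i; rewrite coef0 linear0; apply: submod0.
  exact: induced_free_FPq.
elim: n X A B sA sB => [|n IHn] X A B sA sB FPR [J [b [Ab gb rb]]];
  apply: (step _ _ _ _ _ b) => // m [<-].
have := IHn _ _ _ (submod_rel b sB) (submod_zero _) (FPq_mono FPR) rb.
by apply: eq_FPq => // x; apply: ind0.
Qed.
End Induction.

(** * Lattices *)

Section Lattice.
Variable U : zmodType.

Definition subgroup (A : U -> Prop) :=
  A 0 /\ forall u v, A u -> A v -> A (u - v).

Lemma subgroupMz A u z : subgroup A -> A u -> A (u *~ z).
Proof.
move=> [A0 AB] Au.
have AN v : A v -> A (- v) by move=> Av; rewrite -sub0r; apply: AB.
have An (n : nat) : A (u *+ n).
  elim: n => [|n IHn]; rewrite ?mulr0n // mulrSr -[u in _ + u]opprK.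
  by apply: AB => //; apply: AN.
by case: z => n; [exact: An|]; rewrite NegzE mulrNz; exact/AN/An.
Qed.

Lemma subgroup_sum A (I : finType) (F : I -> U) :
  subgroup A -> (forall i, A (F i)) -> A (\sum_i F i).
Proof.
move=> [A0 AB] AF; apply: big_ind => // u v Au Av.
by rewrite -[v]opprK; apply: (AB) => //; rewrite -sub0r; apply: AB.
Qed.

Definition additive_on (X : zmodType) (A : U -> Prop) (f : U -> X) :=
  forall u v, A u -> A v -> f (u - v) = f u - f v.

Section AdditiveOn.
Variables (X : zmodType) (A : U -> Prop) (f : U -> X).
Hypotheses (gA : subgroup A) (fB : additive_on A f).

Lemma additive_on0 : f 0 = 0.
Proof. by case: gA => A0 _; rewrite -(subrr 0) fB ?subrr. Qed.

Lemma additive_onN u : A u -> f (- u) = - f u.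
Proof. by case: gA => A0 _ Au; rewrite -sub0r fB // additive_on0 sub0r. Qed.

Lemma additive_onD u v : A u -> A v -> f (u + v) = f u + f v.
Proof.
move=> Au Av; have ANv : A (- v) by case: gA => A0 AB; rewrite -sub0r; apply: AB.
by rewrite -[v in LHS]opprK fB // additive_onN // opprK.
Qed.

Lemma additive_onMz u z : A u -> f (u *~ z) = f u *~ z.
Proof.
move=> Au; have fn (n : nat) : f (u *+ n) = f u *+ n.
  elim: n => [|n IHn]; first by rewrite !mulr0n additive_on0.
  by rewrite !mulrS additive_onD ?IHn //; apply: (subgroupMz n gA).
case: z => n; first exact: fn.
by rewrite NegzE !mulrNz additive_onN ?fn //; apply: (subgroupMz n.+1 gA).
Qed.

End AdditiveOn.

(** A lattice is a group that embeds in some Z^r. In this form the property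
    passes to subgroups for free; a basis is extracted only where one is
    needed. *)
Definition lattice (A : U -> Prop) := exists r (f : U -> 'I_r -> int),
  (forall i, additive_on A (fun u => f u i)) /\
  (forall u, A u -> (forall i, f u i = 0) -> u = 0).

Lemma latticeS (A B : U -> Prop) :
  (forall u, B u -> A u) -> lattice A -> lattice B.
Proof.
move=> BA [r [f [fB f0]]]; exists r, f.
by split=> [i u v /BA Au /BA|u /BA]; [exact: fB|exact: f0].
Qed.

(** Hermite reduction on the first coordinate: a basis of the elements where it
    vanishes is completed by an element where it takes its least positive
    value. *)
Lemma lattice_basis (A : U -> Prop) : subgroup A -> lattice A ->
  exists (I : finType) (y : I -> U) (co : U -> I -> int),
    [/\ forall i, A (y i), forall u, A u -> u = \sum_i y i *~ co u i
      & forall z i, co (\sum_k y k *~ z k) i = z i].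
Proof.
move=> gA [r [f [fB f0]]].
elim: r A gA f fB f0 => [|r IHr] A gA f fB f0.
  exists void, (of_void U), (fun _ => of_void int); split=> // u /f0 ->; last by case.
  by rewrite big1 // => -[].
have [A0 AB] := gA; pose A' u := A u /\ f u ord0 = 0.
have gA' : subgroup A'.
  split=> [|u v [Au u0] [Av v0]]; split=> //; last by rewrite fB // u0 v0 subrr.
  - exact: (additive_on0 gA (fB ord0)).
  - exact: AB.
have [||I [y [co [Ay ysp yco]]]] := IHr A' gA' (fun u i => f u (lift ord0 i)).
- by move=> i u v [Au _] [Av _]; apply: fB.
- move=> u [Au u0] u'; apply: f0 => // i.
  by case: (unliftP ord0 i) => [j ->|->].
pose P n := `[< (0 < n)%N /\ exists u, A u /\ f u ord0 = n%:Z >].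
have [exP|nexP] := pselect (exists n, P n); last first.
  exists I, y, co; split=> // [i|u Au]; first by case: (Ay i).
  apply: ysp; split=> //; apply: contrapT => /eqP fu.
  case: nexP; exists `|f u ord0|%N; apply/asboolP; split; first by rewrite absz_gt0.
  have [ge0|lt0] := lerP 0 (f u ord0); first by exists u; rewrite gez0_abs.
  exists (- u); split; first by rewrite -sub0r; apply: AB.
  by rewrite (additive_onN gA (fB ord0)) // ltz0_abs.
case: (ex_minnP exP) => d /asboolP[d_gt0 [b [Ab fb]]] d_min.
have dnz : d%:Z != 0 by rewrite eqz_nat -lt0n.
(* d divides every first coordinate: a nonzero remainder would be a smaller
   positive value. *)
pose q u := (f u ord0 %/ d)%Z.
have fq u : A u -> A' (u - b *~ q u).
  move=> Au; have Abq : A (b *~ q u) by apply: subgroupMz.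
  have E : f (u - b *~ q u) ord0 = (f u ord0 %% d)%Z.
    rewrite fB // (additive_onMz gA (fB ord0) (q u)) // fb.
    rewrite {1}(divz_eq (f u ord0) d) /q -mulrzl intz.
    by rewrite addrC addrA addNr add0r.
  split; first exact: AB.
  rewrite E; apply: contrapT => /eqP nz.
  have : P `|(f u ord0 %% d)%Z|%N.
    apply/asboolP; split; first by rewrite absz_gt0.
    by exists (u - b *~ q u); rewrite E gez0_abs ?modz_ge0 //; split=> //; apply: AB.
  move/d_min; rewrite leqNgt => /negP; apply.
  by rewrite -ltz_nat gez0_abs ?modz_ge0 // ltz_pmod.
exists (I + unit)%type, (fun k => match k with inl i => y i | inr _ => b end),
  (fun u k => match k with inl i => co (u - b *~ q u) i | inr _ => q u end).
have bigE (z : I + unit -> int) :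
    \sum_k (match k with inl i => y i | inr _ => b end) *~ z k =
    \sum_i y i *~ z (inl i) + b *~ z (inr tt).
  by rewrite big_sumType /=; congr (_ + _); rewrite (big_pred1 tt) // => -[].
split=> [[i|_]|u Au|z] //=; first by case: (Ay i).
  by rewrite bigE -ysp ?subrK //; apply: fq.
rewrite bigE; set w := \sum_i _.
have Aw : A' w by apply: subgroup_sum => // i; apply: subgroupMz.
have Abz : A (b *~ z (inr tt)) by apply: subgroupMz.
have qE : q (w + b *~ z (inr tt)) = z (inr tt).
  rewrite /q (additive_onD gA (fB ord0)) //; last by case: Aw.
  rewrite (additive_onMz gA (fB ord0)) // fb (proj2 Aw) add0r.
  by rewrite -mulrzr intz mulKz.
by move=> [i|[]]; rewrite qE // addrK yco.
Qed.

End Lattice.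

(** * Lattices over groups *)

(** Modules induced from the regular module have the additive basis (gen j g);
    maps out of them are defined and compared on it. *)
Section InducedRegular.
Variables (S T : monoidType) (I : finType) (rho : mxrep S (monoid_ring T) I).
Local Notation M := (induced rho (monoid_ring T)^o).

Definition gen (j : I) (g : T) : M :=
  @of_coef _ _ _ rho (monoid_ring T)^o (fun i => if i == j then mr g else 0).

Lemma scale_gen s j g i : coef (mr s *: gen j g) i = rho s i j * mr g.
Proof.
rewrite coef_scale (bigD1 j) //= of_coefE eqxx big1 ?addr0 // => k ne_kj.
by rewrite of_coefE (negPf ne_kj) scaler0.
Qed.

Lemma induced_ind (P : M -> Prop) :
  P 0 -> (forall x y, P x -> P y -> P (x - y)) ->
  (forall j g, P (gen j g)) -> forall x, P x.
Proof.
move=> P0 PB Pg x.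
have PD u v : P u -> P v -> P (u + v).
  by move=> Pu Pv; rewrite -[v]opprK; apply: (PB) => //; rewrite -sub0r; apply: PB.
pose one j c : M := @of_coef _ _ _ rho (monoid_ring T)^o (fun i => if i == j then c else 0).
have Pone j c : P (one j c).
  elim/mr_ind: c => [|c d Pc Pd|g]; last exact: Pg.
    rewrite (_ : one j 0 = 0) //; apply/coefP=> i.
    by rewrite of_coefE coef0 if_same.
  rewrite (_ : one j _ = one j c - one j d); first exact: PB.
  by apply/coefP=> i; rewrite coefB !of_coefE; case: ifP; rewrite ?subr0.
rewrite (_ : x = \sum_j one j (coef x j)); first by apply: big_ind.
apply/coefP=> i; rewrite coef_sum (bigD1 i) //= of_coefE eqxx.
by rewrite big1 ?addr0 // => j ne_ji; rewrite of_coefE eq_sym (negPf ne_ji).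
Qed.

Section Lift.
Variables (X : zmodType) (F : I -> T -> X).

Definition ind_lift (x : M) : X := \sum_i mlift (F i) (coef x i).

Lemma ind_liftD x y : ind_lift (x + y) = ind_lift x + ind_lift y.
Proof.
by rewrite /ind_lift -big_split; apply: eq_bigr => i _; rewrite coefD mliftD.
Qed.

Lemma ind_lift0 : ind_lift 0 = 0.
Proof. by rewrite /ind_lift big1 // => i _; rewrite coef0 mlift0. Qed.

Lemma ind_liftB x y : ind_lift (x - y) = ind_lift x - ind_lift y.
Proof. by apply: (addIr (ind_lift y)); rewrite -ind_liftD !subrK. Qed.

Lemma ind_lift_gen j g : ind_lift (gen j g) = F j g.
Proof.
rewrite /ind_lift (bigD1 j) //= of_coefE eqxx mlift_mr big1 ?addr0 // => i ne_ij.
by rewrite of_coefE (negPf ne_ij) mlift0.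
Qed.

Lemma ind_lift_eq (f : M -> X) :
  (forall x y, f (x - y) = f x - f y) ->
  (forall j g, f (gen j g) = F j g) -> forall x, f x = ind_lift x.
Proof.
move=> fB fg; apply: induced_ind => [|x y fx fy|j g].
- by rewrite ind_lift0 -[X in f X](subrr 0) fB subrr.
- by rewrite fB ind_liftB fx fy.
by rewrite fg ind_lift_gen.
Qed.

End Lift.

Lemma ind_lift_linear (V : lmodType (monoid_ring S)) (F : I -> T -> V) :
  (forall s j g, ind_lift F (mr s *: gen j g) = mr s *: F j g) ->
  linear (ind_lift F).
Proof.
move=> Fs c u v; apply: linear_mr => [x y|s x]; first exact: ind_liftD.
have sB (U : lmodType (monoid_ring S)) (x1 y1 : U) :
  mr s *: (x1 - y1) = mr s *: x1 - mr s *: y1 by apply: scalerBr.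
transitivity (ind_lift (fun j g => mr s *: F j g) x).
  by apply: (ind_lift_eq (f := fun x => ind_lift F (mr s *: x))) => [x1 y1|//];
    rewrite sB ind_liftB.
apply/esym/(ind_lift_eq (f := fun x => mr s *: ind_lift F x)) => [x1 y1|j g].
  by rewrite ind_liftB sB.
by rewrite ind_lift_gen.
Qed.

End InducedRegular.

Section GroupLattice.
Variables (G : groupType) (W : lmodType (monoid_ring G)) (A : W -> Prop).
Local Notation ZG := (monoid_ring G).
Hypotheses (sA : submod A) (I : finType) (y : I -> W) (co : W -> I -> int).
Hypotheses (Ay : forall i, A (y i))
  (ysp : forall u, A u -> u = \sum_i y i *~ co u i)
  (yco : forall z i, co (\sum_k y k *~ z k) i = z i).

Lemma co_basis i j : co (y j) i = (i == j)%:R.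
Proof.
rewrite -(yco (fun k => (k == j)%:R)); congr (co _ _).
by rewrite (bigD1 j) //= eqxx big1 ?addr0 // => k /negPf ->; rewrite mulr0z.
Qed.

Lemma co_act s t i j :
  co (mr s *: (mr t *: y j)) i = \sum_l co (mr s *: y l) i * co (mr t *: y j) l.
Proof.
rewrite [in LHS](ysp (submodZ sA (mr t) (Ay j))) scaler_sumr.
rewrite -(yco (fun i => \sum_l co (mr s *: y l) i * co (mr t *: y j) l)).
congr (co _ _).
transitivity (\sum_l \sum_k y k *~ (co (mr s *: y l) k * co (mr t *: y j) l)).
  apply: eq_bigr => l _; rewrite -scalerMzr.
  rewrite [in LHS](ysp (submodZ sA (mr s) (Ay l))) mulrz_suml.
  by apply: eq_bigr => k _; rewrite mulrzA.
by rewrite exchange_big; apply: eq_bigr => k _; rewrite mulrz_sumr.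
Qed.

(** The matrix of the diagonal action of s on ZG (x) A, in the basis y of A. *)
Definition diag_mx_fun s i j : ZG := mkmalgU s (co (mr s *: y j) i).

Lemma mkmalgUMz (s : G) (c z : int) :
  mkmalgU s (c * z) = mkmalgU s c *~ z :> ZG.
Proof. by rewrite !mkmalgU_mr mulrzA. Qed.

Lemma mkmalgU_sum (s : G) (J : finType) (F : J -> int) :
  mkmalgU s (\sum_j F j) = \sum_j mkmalgU s (F j) :> ZG.
Proof. exact: (big_morph _ (monalgUD s) (monalgU0 s)). Qed.

Fact diag_mx1 i j : diag_mx_fun 1%g i j = (i == j)%:R.
Proof.
rewrite /diag_mx_fun mr_1 scale1r co_basis.
by case: eqP => _ //; apply: monalgU0.
Qed.

Fact diag_mxM s t i j :
  diag_mx_fun (s * t)%g i j = \sum_l diag_mx_fun s i l * diag_mx_fun t l j.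
Proof.
rewrite /diag_mx_fun -mrM -scalerA co_act mkmalgU_sum.
by apply: eq_bigr => l _; rewrite [RHS]mr_mulUU.
Qed.

Definition diag_rep : mxrep G ZG I := MxRep diag_mx1 diag_mxM.

(** The diagonal action on ZG (x) A is isomorphic to the action on the first
    factor, through g (x) a |-> g (x) g^-1 a. *)
Lemma diag_free_FPq n : FPqT n (induced diag_rep ZG^o).
Proof.
pose F j g : {ffun I -> ZG^o} :=
  [ffun l => mkmalgU g (co (mr (g^-1)%g *: y j) l)].
have actF s j g : ind_lift F (mr s *: gen diag_rep j g) = mr s *: F j g.
  transitivity (\sum_i F i (s * g)%g *~ co (mr s *: y j) i).
    apply: eq_bigr => i _; rewrite scale_gen [_ * _]mr_mulUU mulr1.
    exact: mliftU.
  apply/ffunP=> l; rewrite sum_ffunE !ffunE.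
  rewrite [RHS]mr_mulUU mul1r.
  have -> : co (mr g^-1%g *: y j) l =
      \sum_i co (mr (s * g)^-1%g *: y i) l * co (mr s *: y j) i.
    by rewrite -co_act scalerA mrM invgM -mulgA mulVg mulg1.
  rewrite mkmalgU_sum; apply: eq_bigr => i _.
  by rewrite ffunMzE ffunE -mkmalgUMz.
have h_lin := ind_lift_linear actF.
pose hM := GRing.isLinear.Build ZG _ _ _ _ h_lin.
pose h : {linear induced diag_rep ZG^o -> {ffun I -> ZG^o}} :=
  HB.pack (ind_lift (rho := diag_rep) F) hM.
pose b := lincomb (fun l => gen diag_rep l 1%g).
have bh_gen j g : b (F j g) = gen diag_rep j g.
  apply/coefP=> i; rewrite coef_sum of_coefE.
  transitivity (\sum_l mkmalgU g (co (mr g *: y l) i * co (mr g^-1%g *: y j) l)).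
    apply: eq_bigr => l _; rewrite ffunE mkmalgU_mr -scalerMzl coefMz scale_gen.
    by rewrite mr_1 mulr1 -mkmalgUMz.
  rewrite -mkmalgU_sum -co_act scalerA mrM mulgV mr_1 scale1r co_basis.
  by case: eqP => // _; apply: monalgU0.
apply: (FPq_retract n (b := b) (h := h)) => // x _.
have idE : x = ind_lift (gen diag_rep) x.
  exact: (@ind_lift_eq _ _ _ diag_rep _ (gen diag_rep) id).
have bhE : b (h x) = ind_lift (gen diag_rep) x.
  apply: (@ind_lift_eq _ _ _ diag_rep _ (gen diag_rep) (fun x => b (h x))).
    by move=> u v; rewrite [h _]linearB [b _]linearB.
  by move=> j g; rewrite /= ind_lift_gen bh_gen.
exact: etrans bhE (esym idE).
Qed.

(** Tensoring a resolution of Z with A, with the diagonal action, resolves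
    Z (x) A = A. *)
Lemma lattice_basis_FPq n : FPqT n (trivial_module G) -> FPq n A (fun u => u = 0).
Proof.
move=> FPZ.
have := induced_FPq (diag_free_FPq n) (submod_full _) (submod_zero _) FPZ.
pose f (x : induced diag_rep (trivial_module G)) : W :=
  \sum_i y i *~ (coef x i : int).
have fD u v : f (u + v) = f u + f v.
  rewrite /f -big_split; apply: eq_bigr => i _.
  by rewrite coefD mulrzDr.
have fs s u : f (mr s *: u) = mr s *: f u.
  rewrite scaler_sumr.
  transitivity (\sum_i \sum_j y i *~ (co (mr s *: y j) i * (coef u j : int))).
    apply: eq_bigr => i _; rewrite coef_scale -mulrz_sumr; congr (_ *~ _).
    apply: eq_bigr => j _; rewrite [LHS](_ : _ =
      augmentation (diag_rep s i j) * (coef u j : int)) //.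
    by rewrite augmentationU.
  rewrite exchange_big; apply: eq_bigr => j _.
  rewrite -scalerMzr [in RHS](ysp (submodZ sA (mr s) (Ay j))) mulrz_suml.
  by apply: eq_bigr => i _; rewrite mulrzA.
apply: (FPq_push (f := f)); split=> [|||u _|u _|w Aw].
- exact/submod_ind/submod_full.
- exact: submod_zero.
- apply: linear_mod_eq (submod_zero _) _; exact: linear_mr.
- by apply: submod_sum => // i; rewrite -scaler_int; apply: submodZ.
- split=> [/ind0->|fu i].
    by rewrite /f big1 // => i _; rewrite coef0 mulr0z.
  rewrite -[LHS](yco (coef u) i) [X in co X](_ : _ = 0) //.
  have := yco (fun _ => 0) i; rewrite big1 // => j _; exact: mulr0z.
exists (@of_coef _ _ _ diag_rep (trivial_module G) (co w)); split=> //.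
apply/(eqmod_eq (submod_zero _)); rewrite {1}(ysp Aw).
by apply: eq_bigr => i _; rewrite of_coefE.
Qed.

End GroupLattice.

Lemma submod_subgroup (R : pzRingType) (U : lmodType R) (A : U -> Prop) :
  submod A -> subgroup A.
Proof. by move=> sA; split=> [|u v]; [apply: submod0|apply: submodB]. Qed.

Lemma group_lattice_FPq n (G : groupType) (W : lmodType (monoid_ring G))
    (A : W -> Prop) :
  submod A -> lattice A -> FPqT n (trivial_module G) ->
  FPq n A (fun u => u = 0).
Proof.
move=> sA lA; have [I [y [co [Ay ysp yco]]]] := lattice_basis (submod_subgroup sA) lA.
exact: lattice_basis_FPq yco n.
Qed.

(** * Left ideals *)

(** The number of elements of F above x decreases strictly along the order. *)
Lemma finite_ind (T : eqType) (F : set T) (lt : T -> T -> Prop) (P : T -> Prop) :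
  finite_set F -> (forall x, ~ lt x x) ->
  (forall x y z, lt x y -> lt y z -> lt x z) ->
  (forall x, (forall y, F y -> lt x y -> P y) -> P x) -> forall x, P x.
Proof.
move=> /finite_seqP[s Fs] lt_irr lt_tr IH x.
pose m x := count (fun y => `[< lt x y >]) s.
have [n] := ubnP (m x); elim: n x => // n IHn x le_n; apply: IH => y Fy xy.
apply: IHn; rewrite -ltnS; apply: leq_trans le_n; rewrite ltnS.
have ys : y \in s by rewrite Fs in Fy.
pose b z := `[< lt x z >] && ~~ `[< lt y z >].
have b_gt0 : (0 < count b s)%N.
  rewrite -has_count; apply/hasP; exists y => //.
  by rewrite /b; apply/andP; split; [apply/asboolP|apply/asboolP/lt_irr].
apply: leq_trans (_ : (m y + count b s <= _)%N).
  by rewrite -[X in (X <= _)%N]addn1 leq_add2l.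
rewrite -count_predUI (eq_in_count (a1 := predI _ _) (a2 := pred0)); last first.
  by move=> z _; rewrite /= /b; case: `[< lt y z >]; rewrite ?andbF.
rewrite count_pred0 addn0; apply: sub_count => z /orP[/asboolP yz|/andP[]//].
exact/asboolP/(lt_tr _ _ _ xy).
Qed.

Section LeftIdeals.
Variable S : monoidType.
Local Notation ZS := (monoid_ring S).

Definition left_closed (I : S -> Prop) := forall s x, I x -> I (s * x)%g.

Definition left_multiple (x y : S) := exists s, y = (s * x)%g.

Lemma left_closed_multiple x : left_closed (left_multiple x).
Proof. by move=> s _ [t ->]; exists (s * t)%g; rewrite mulgA. Qed.

Lemma submod_zspan (I : S -> Prop) :
  left_closed I -> submod (U := ZS^o) (zspan I).
Proof.
move=> lI; apply: submod_mr => [|u v|s]; [exact: zspan0|exact: zspanB|].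
apply: zspan_ind => [|u v Iu Iv|k Ik].
- by rewrite scaler0; apply: zspan0.
- by rewrite [_ *: _]scalerBr; apply: zspanB.
have -> : mr s *: (mr k : ZS^o) = mr (s * k)%g := mrM s k.
apply: zspanU; exact: lI.
Qed.

Lemma eq_zspan (I J : S -> Prop) u :
  (forall x, I x <-> J x) -> zspan I u <-> zspan J u.
Proof. by move=> IJ; split; apply: zspanS => k /IJ. Qed.

Fact ffun_const_linear :
  linear (fun u : ZS^o => [ffun _ : unit => u] : {ffun unit -> ZS^o}).
Proof. by move=> c u v; apply/ffunP=> i; rewrite !ffunE. Qed.

(** ZSe is the image of the idempotent endomorphism u |-> u e of ZS. *)
Lemma idempotent_ideal_FPq n (e : S) : (e * e = e)%g ->
  FPq n (zspan (left_multiple e) : ZS^o -> Prop) (fun u => u = 0).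
Proof.
move=> ee.
pose hM := GRing.isLinear.Build ZS _ _ _ _ ffun_const_linear.
pose h : {linear ZS^o -> {ffun unit -> ZS^o}} :=
  HB.pack (fun u : ZS^o => [ffun _ : unit => u]) hM.
pose b := lincomb (fun _ : unit => mr e : ZS^o).
have sE := submod_zspan (@left_closed_multiple e).
apply: (FPq_retract n (b := b) (h := h) sE) => [c|].
  by apply: submod_lincomb => // _; apply: zspanU; exists 1%g; rewrite mul1g.
have bhE u : b (h u) = u * mr e.
  by rewrite /b /= /lincomb (big_pred1 tt) ?ffunE // => -[].
move=> u Eu; apply: etrans (bhE u) _; move: u Eu.
apply: zspan_ind => [|u v|k [s ->]].
- by rewrite mul0r.
- by rewrite mulrBl => -> ->.
by rewrite mrM -mulgA ee.
Qed.

Hypothesis S_regular : regular_monoid S.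
Hypothesis S_left : finite_set [set I : set S | left_ideal I]%classic.

Lemma principal_left_ideal_finite :
  exists ys : seq S, forall x, exists2 y, y \in ys & greenL x y.
Proof.
have /finite_seqP[s sE] : finite_set (range (@principal_left_ideal S)).
  apply: sub_finite_set S_left => _ [x _ <-]; split.
    by exists (1 * x)%g; exists 1%g.
  by move=> t _ [u _ <-]; exists (t * u)%g => //; rewrite mulgA.
pose c (I : set S) := xget 1%g [set x | principal_left_ideal x = I]%classic.
exists (map c s) => x.
exists (c (principal_left_ideal x)).
  apply: map_f; have : range (@principal_left_ideal S) (principal_left_ideal x).
    by exists x.
  by rewrite sE.
apply/esym; apply: (@xgetPex _ 1%g
  [set y | principal_left_ideal y = principal_left_ideal x]%classic).
by exists x.
Qed.

Lemma regular_idempotent x :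
  exists e, [/\ (e * e = e)%g, left_multiple x e & left_multiple e x].
Proof.
have [y xyx] := S_regular x; exists (y * x)%g; split; last 1 first.
- by exists x; rewrite mulgA.
- by rewrite -mulgA [(x * _)%g]mulgA xyx.
by exists y.
Qed.

Lemma left_multiple_trans x y z :
  left_multiple x y -> left_multiple y z -> left_multiple x z.
Proof. by move=> [s ->] [t ->]; exists (t * s)%g; rewrite mulgA. Qed.

(** Every left ideal is a finite union of ideals Se with e idempotent. Adding
    one Se at a time, (I u Se)/I = Se/(I n Se), and I n Se is again a left
    ideal, of which only FP_(n-1) is needed. *)
Lemma left_ideal_FPq n (I : S -> Prop) : left_closed I ->
  FPq n (zspan I : ZS^o -> Prop) (fun u => u = 0).
Proof.
move: n I; have s0 := submod_zero ZS^o; have [ys ysP] := principal_left_ideal_finite.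
suff step m : (forall I k, left_closed I -> m = k.+1 ->
      FPq k (zspan I : ZS^o -> Prop) (fun u => u = 0)) ->
    forall I, left_closed I -> FPq m (zspan I : ZS^o -> Prop) (fun u => u = 0).
  elim=> [|n IHn] I lI; apply: step => // J k lJ [<-]; exact: IHn.
move=> IH I lI.
pose U (xs : seq S) x := exists y, [/\ y \in xs, I y & left_multiple y x].
have lU xs : left_closed (U xs).
  move=> s x [y [yxs Iy yx]]; exists y; split=> //.
  exact: left_closed_multiple.
suff FPU (xs : seq S) : FPq m (zspan (U xs) : ZS^o -> Prop) (fun u => u = 0).
  apply: eq_FPq (FPU ys) => // u; apply: eq_zspan => x.
  split=> [[y [_ Iy [s ->]]]|Ix]; first exact: lI.
  have [y yys /greenLP[[s xs] [t yt]]] := ysP x.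
  by exists y; split=> //; [rewrite yt; apply: lI|exists s].
elim: xs => [|y xs IHxs].
  apply: FPq_trivial => //; apply: zspan_ind => // [u v -> ->|k [y []//]].
  by rewrite subr0.
have [Iy|nIy] := pselect (I y); last first.
  apply: eq_FPq IHxs => // u; apply: eq_zspan => x.
  split=> [[z [zxs Iz zx]]|[z []]].
    by exists z; rewrite inE zxs orbT.
  by rewrite inE => /orP[/eqP->//|zxs Iz zx]; exists z.
have [e [ee ye ey]] := regular_idempotent y.
have UE x : left_multiple e x -> U (y :: xs) x.
  by move=> ex; exists y; rewrite mem_head; split=> //; apply: left_multiple_trans ex.
have US x : U xs x -> U (y :: xs) x.
  by move=> [z [zxs Iz zx]]; exists z; rewrite inE zxs orbT.
have lEU : left_closed (fun x => left_multiple e x /\ U xs x).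
  by move=> s x [ex Ux]; split; [apply: left_closed_multiple|apply: lU].
have sE := submod_zspan (@left_closed_multiple e).
apply: (FPq_ext (B := zspan (U xs) : ZS^o -> Prop)) IHxs _ => //.
- exact: submod_zspan.
- exact: submod_zspan.
- by move=> u; apply: zspanS.
- by move=> u ->; apply: zspan0.
apply: (FPq_push (f := id)
    (A := zspan (left_multiple e) : ZS^o -> Prop)
    (B := zspan (fun x => left_multiple e x /\ U xs x) : ZS^o -> Prop)).
  split=> // [||u|u Eu|].
  - exact: submod_zspan.
  - by apply: linear_mod_eq => //; apply: submod_zspan.
  - exact: zspanS.
  - split; first by apply: zspanS => k [].
    by move=> Uu k nz; split; [apply: Eu|apply: Uu].
  apply: zspan_ind => [|u v [u' [Eu' Uu]] [v' [Ev' Uv]]|k [z]].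
  - by exists 0; split; [apply: zspan0|rewrite /eqmod subr0; apply: zspan0].
  - exists (u' - v'); split; first exact: zspanB.
    exact: (eqmodB (submod_zspan (lU xs)) Uu Uv).
  rewrite inE => -[/orP[/eqP->|zxs] Iz zk].
    exists (mr k); split; last by rewrite /eqmod subrr; apply: zspan0.
    by apply: zspanU; apply: left_multiple_trans ey zk.
  exists 0; split; first exact: zspan0.
  by rewrite /eqmod subr0; apply: zspanU; exists z.
apply: (FPq_quot
  (B := zspan (fun x => left_multiple e x /\ U xs x) : ZS^o -> Prop) sE _ s0) => [|u|u ->||k mk].
- exact: submod_zspan.
- by apply: zspanS => k [].
- exact: zspan0.
- exact: idempotent_ideal_FPq.
exact: IH.
Qed.

End LeftIdeals.

(** * The Schutzenberger representation *)

Section LClass.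
Variables (S : monoidType) (e : S) (ee : (e * e)%g = e).
Local Notation ZS := (monoid_ring S).
Local Notation G := (maximal_subgroup ee).
Local Notation ZG := (monoid_ring G).

Lemma ms_idl (g : G) : (e * sval g)%g = sval g.
Proof. by apply: (Hclass_idl ee); apply: set_mem (svalP g). Qed.

Lemma ms_idr (g : G) : (sval g * e)%g = sval g.
Proof. by apply: (Hclass_idr ee); apply: set_mem (svalP g). Qed.

Lemma ms_mulgV (g : G) : (sval g * sval g^-1%g)%g = e.
Proof. by rewrite -[RHS]/(sval (1%g : G)) -(mulgV g). Qed.

Lemma ms_mulVg (g : G) : (sval g^-1%g * sval g)%g = e.
Proof. by rewrite -[RHS]/(sval (1%g : G)) -(mulVg g). Qed.

(** Green's L-class of e. Since e is idempotent, right multiplication makes it a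
    free right G-set whose orbits are its intersections with the R-classes. *)
Definition Lclass l := left_multiple e l /\ left_multiple l e.

Lemma Lclass_idr l : Lclass l -> (l * e)%g = l.
Proof. by case=> -[s ->] _; rewrite -mulgA ee. Qed.

Lemma Lclass_id : Lclass e.
Proof. by split; exists 1%g; rewrite mul1g. Qed.

Lemma Lclass_mulG l (g : G) : Lclass (l * sval g)%g <-> Lclass (l * e)%g.
Proof.
suff impl k (h : G) : Lclass k -> Lclass (k * sval h)%g.
  split=> [/impl|/impl] => [/(_ g^-1%g)|/(_ g)].
    by rewrite -mulgA ms_mulgV.
  by rewrite -mulgA ms_idl.
move=> kL; have [_ [t et]] := kL; split.
  by exists (k * sval h)%g; rewrite -mulgA ms_idr.
exists (sval h^-1%g * t)%g.
by rewrite mulgA -[(_ * t * k)%g]mulgA -et ms_idr ms_mulVg.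
Qed.

Lemma Lclass_mull s l : left_multiple e l -> Lclass (s * l)%g -> Lclass l.
Proof. by move=> el [_ [t et]]; split=> //; exists (t * s)%g; rewrite -mulgA. Qed.

(** Green's lemma: two R-related elements of L differ by an element of G. *)
Lemma Lclass_greenR l r : Lclass l -> Lclass r -> greenR l r ->
  exists g : G, l = (r * sval g)%g.
Proof.
move=> lL rL /greenRP[[u lu] [v rv]]; have [_ [t et]] := rL.
have rtr : (r * t * r)%g = r by rewrite -mulgA -et Lclass_idr.
have gE : (r * (t * l))%g = l by rewrite lu !mulgA rtr.
suff Hg : Hclass e (t * l)%g by exists (exist _ (t * l)%g (mem_set Hg)).
have [_ [t' et']] := lL.
split; [apply/greenLP|apply/greenRP]; split.
- by exists (t' * r)%g; rewrite -mulgA gE.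
- by exists (t * l)%g; rewrite -mulgA Lclass_idr.
- by exists v; rewrite -mulgA -rv -et.
- by exists u; rewrite lu mulgA -et.
Qed.

(** Coordinates on the L-class: every element is uniquely r_i g, with r_i in a
    finite set of representatives of the R-classes and g in G. *)
Record transversal := Transversal {
  tr_index : finType;
  tr_rep : tr_index -> S;
  tr_ix : S -> tr_index;
  tr_grp : S -> G;
  tr_repL : forall i, Lclass (tr_rep i);
  trK : forall l, Lclass l -> (tr_rep (tr_ix l) * sval (tr_grp l))%g = l;
  tr_ixK : forall i (g : G), tr_ix (tr_rep i * sval g)%g = i;
  tr_grpK : forall i (g : G), tr_grp (tr_rep i * sval g)%g = g }.

Arguments tr_rep : clear implicits.
Arguments tr_ix : clear implicits.
Arguments tr_grp : clear implicits.
Arguments tr_repL : clear implicits.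
Arguments trK : clear implicits.

(** The orbits are indexed by the principal right ideals lS with l in L, of which
    there are finitely many. *)
Lemma transversal_exists :
  finite_set [set I : set S | right_ideal I]%classic ->
  exists _ : transversal, True.
Proof.
move=> S_right.
have /finite_seqP[s sE] : finite_set (@principal_right_ideal S @` Lclass)%classic.
  apply: sub_finite_set S_right => _ [x _ <-]; split.
    by exists (x * 1)%g; exists 1%g.
  by move=> t _ [u _ <-]; exists (u * t)%g => //; rewrite mulgA.
have /choice[r rP] (J : seq_sub s) :
    exists l, Lclass l /\ principal_right_ideal l = ssval J.
  have : [set` s]%classic (ssval J) by apply: (ssvalP J).
  by rewrite -sE => -[l lL <-]; exists l.
have rL J : Lclass (r J) by case: (rP J).
have decomp l : Lclass l -> exists p : seq_sub s * G, (r p.1 * sval p.2)%g = l.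
  move=> lL; have : principal_right_ideal l \in s.
    have : (@principal_right_ideal S @` Lclass)%classic (principal_right_ideal l).
      by exists l.
    by rewrite sE.
  move=> lJ; have [_ rJ] := rP (SeqSub lJ).
  have [|g lg] := @Lclass_greenR l _ lL (rL (SeqSub lJ)); first by rewrite /greenR rJ.
  by exists (SeqSub lJ, g).
(* Off the L-class the coordinates are junk, taken from e. *)
have /choice[p pP] l : exists p : seq_sub s * G, Lclass l -> (r p.1 * sval p.2)%g = l.
  have [/decomp[p pl]|nlL] := pselect (Lclass l); first by exists p.
  by have [p _] := decomp e Lclass_id; exists p.
have inj i (g : G) j (h : G) : (r i * sval g)%g = (r j * sval h)%g -> i = j /\ g = h.
  move=> E; have eR k : (r k * e)%g = r k := Lclass_idr (rL k).
  have ij : i = j.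
    apply: val_inj; rewrite /= -(proj2 (rP i)) -(proj2 (rP j)).
    apply/greenRP; split.
      exists (sval h * sval g^-1)%g.
      by rewrite mulgA -E -mulgA ms_mulgV eR.
    exists (sval g * sval h^-1)%g.
    by rewrite mulgA E -mulgA ms_mulgV eR.
  split=> //; apply: val_inj; rewrite -/(sval g) -/(sval h) /=.
  have [_ [t et]] := rL i; rewrite -ij in E.
  have tE (k : G) : (t * (r i * sval k))%g = sval k by rewrite mulgA -et ms_idl.
  by rewrite -[LHS]tE E tE.
have rgL i (g : G) : Lclass (r i * sval g)%g.
  by apply/Lclass_mulG; rewrite Lclass_idr.
unshelve eexists (@Transversal (seq_sub s) r
  (fun l => (p l).1) (fun l => (p l).2) rL pP _ _) => //.
- by move=> i g; case: (inj _ _ _ _ (pP _ (rgL i g))).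
- by move=> i g; case: (inj _ _ _ _ (pP _ (rgL i g))).
Qed.

Variable tr : transversal.
Local Notation I := (tr_index tr).
Local Notation r := (tr_rep tr).

(** Left multiplication by s sends r_j to some r_i g, or out of the L-class; in
    the latter case the column is zero. *)
Definition schutz_fun s i j : ZG :=
  if `[< Lclass (s * r j) >] && (tr_ix tr (s * r j) == i)
  then mr (tr_grp tr (s * r j)) else 0.

Lemma schutz_out s i j : ~ Lclass (s * r j)%g -> schutz_fun s i j = 0.
Proof. by move=> nL; rewrite /schutz_fun asboolF. Qed.

Lemma schutz_ne s i j : tr_ix tr (s * r j) != i -> schutz_fun s i j = 0.
Proof. by rewrite /schutz_fun => /negPf ->; rewrite andbF. Qed.

Lemma schutz_in s j : Lclass (s * r j)%g ->
  schutz_fun s (tr_ix tr (s * r j)) j = mr (tr_grp tr (s * r j)).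
Proof. by move=> sL; rewrite /schutz_fun asboolT // eqxx. Qed.

Fact schutz1 i j : schutz_fun 1%g i j = (i == j)%:R.
Proof.
rewrite /schutz_fun mul1g (asboolT (tr_repL tr j)) /=.
have -> : r j = (r j * sval (1%g : G))%g.
  by rewrite [RHS]Lclass_idr //; apply: tr_repL.
by rewrite tr_ixK tr_grpK eq_sym; case: eqP.
Qed.

(** Once t r_j has left the L-class it never returns, which makes the truncation
    multiplicative. *)
Fact schutzM s t i j :
  schutz_fun (s * t)%g i j = \sum_l schutz_fun s i l * schutz_fun t l j.
Proof.
have er : left_multiple e (r j) by case: (tr_repL tr j).
have etr : left_multiple e (t * r j)%g by apply: left_closed_multiple.
have [tL|ntL] := pselect (Lclass (t * r j)%g); last first.
  rewrite schutz_out ?big1 // => [l _|]; first by rewrite (schutz_out l ntL) mulr0.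
  by rewrite -mulgA => /(Lclass_mull etr).
rewrite (bigD1 (tr_ix tr (t * r j)%g)) //= big1 ?addr0 => [|l ne_l]; last first.
  by rewrite (@schutz_ne t) ?mulr0 // eq_sym.
rewrite (schutz_in tL); set l := tr_ix tr _; set g := tr_grp tr _.
have E : (s * t * r j)%g = (s * r l * sval g)%g by rewrite -!mulgA trK.
have re : (s * r l * e)%g = (s * r l)%g by rewrite -mulgA (Lclass_idr (tr_repL tr l)).
have LE : Lclass (s * t * r j)%g <-> Lclass (s * r l)%g.
  by rewrite E; apply: iff_trans (Lclass_mulG _ _) _; rewrite re.
have [sL|nsL] := pselect (Lclass (s * r l)%g); last first.
  by rewrite !schutz_out ?mul0r // => /LE.
have E' : (s * t * r j)%g =
    (r (tr_ix tr (s * r l)) * sval (tr_grp tr (s * r l) * g)%g)%g.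
  by rewrite E -[in LHS](trK tr _ sL) -mulgA.
rewrite /schutz_fun (asboolT (LE.2 sL)) (asboolT sL) E' tr_ixK tr_grpK /=.
by case: eqP => _; rewrite ?mrM ?mul0r.
Qed.

Definition schutz : mxrep S ZG I := MxRep schutz1 schutzM.

Section Push.
Variables (X : lmodType ZG) (U : lmodType ZS) (kappa : X -> U) (B : U -> Prop).
Hypothesis kD : forall x y, kappa (x + y) = kappa x + kappa y.
Hypothesis kG : forall g x, kappa (mr g *: x) = mr (sval g) *: kappa x.

(** The map r (x) x |-> r kappa(x) on ZL (x)_ZG X. *)
Definition schutz_push (x : induced schutz X) : U :=
  \sum_i mr (r i) *: kappa (coef x i).

Lemma schutz_pushD x y : schutz_push (x + y) = schutz_push x + schutz_push y.
Proof.
by rewrite /schutz_push -big_split; apply: eq_bigr => i _; rewrite coefD kD scalerDr.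
Qed.

Lemma kappa0 : kappa 0 = 0.
Proof. by apply: (addIr (kappa 0)); rewrite -kD !add0r. Qed.

Lemma schutz_push0 : schutz_push 0 = 0.
Proof. by rewrite /schutz_push big1 // => i _; rewrite coef0 kappa0 scaler0. Qed.

(** Linearity fails only where a product s r_j leaves the L-class, so it holds
    modulo any B that absorbs those products. *)
Lemma schutz_push_linear (A : X -> Prop) : submod A -> submod B ->
  (forall s x, left_multiple e s -> ~ Lclass s -> A x -> B (mr s *: kappa x)) ->
  linear_mod (ind (rho := schutz) A) B schutz_push.
Proof.
move=> sA sB kB; apply: linear_mod_mr => // [|x y|s x Ax].
- exact: submod_ind.
- exact: schutz_pushD.
have kS (F : I -> X) : kappa (\sum_j F j) = \sum_j kappa (F j).
  exact: (big_morph kappa kD kappa0).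
have -> : schutz_push (mr s *: x) =
    \sum_j \sum_i mr (r i) *: kappa (schutz s i j *: coef x j).
  rewrite exchange_big; apply: eq_bigr => i _.
  by rewrite coef_scale kS scaler_sumr.
rewrite scaler_sumr; apply: eqmod_sum => // j.
rewrite scalerA mrM.
have [sL|nsL] := pselect (Lclass (s * r j)%g).
  apply: (eqmod_eq sB).
  rewrite (bigD1 (tr_ix tr (s * r j))) //= big1 ?addr0 => [|i ne_i].
    by rewrite (schutz_in sL) kG scalerA mrM trK.
  by rewrite schutz_ne 1?eq_sym // scale0r kappa0 scaler0.
rewrite big1 => [|i _]; last by rewrite /= schutz_out // scale0r kappa0 scaler0.
rewrite /eqmod sub0r; apply: submodN => //; apply: kB => //.
by apply: left_closed_multiple; case: (tr_repL tr j).
Qed.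

End Push.
End LClass.

Arguments tr_rep {S e ee} t i.
Arguments tr_ix {S e ee} t l.
Arguments tr_grp {S e ee} t l.
Arguments tr_repL {S e ee} t i.
Arguments trK {S e ee} t [l].

Lemma mlift_hom (S T : monoidType) (f : T -> S) :
  {morph f : g h / (g * h)%g >-> (g * h)%g} ->
  forall g x, mlift (fun h => mr (f h)) (mr g * x) =
    mr (f g) * mlift (fun h => mr (f h)) x.
Proof.
move=> fM g; elim/mr_ind => [|x y IHx IHy|h].
- by rewrite mulr0 mlift0 mulr0.
- by rewrite mulrBr !mliftB IHx IHy mulrBr.
by rewrite mrM !mlift_mr fM mrM.
Qed.

Section SchutzFree.
Variables (S : monoidType) (e : S) (ee : (e * e)%g = e).
Local Notation ZS := (monoid_ring S).
Local Notation G := (maximal_subgroup ee).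
Local Notation ZG := (monoid_ring G).
Variable tr : transversal ee.
Local Notation M := (induced (schutz tr) ZG^o).

Definition ms_incl : ZG -> ZS := mlift (fun g : G => mr (sval g)).

Lemma ms_incl0 : ms_incl 0 = 0. Proof. exact: mlift0. Qed.

Lemma ms_inclD x y : ms_incl (x + y) = ms_incl x + ms_incl y.
Proof. exact: mliftD. Qed.

Lemma ms_inclB x y : ms_incl (x - y) = ms_incl x - ms_incl y.
Proof. exact: mliftB. Qed.

Lemma ms_incl_mr g : ms_incl (mr g) = mr (sval g).
Proof. exact: mlift_mr. Qed.

Lemma ms_incl_act (g : G) x : ms_incl (mr g * x) = mr (sval g) * ms_incl x.
Proof. exact: mlift_hom. Qed.

Definition schutz_free_map (x : M) : ZS^o :=
  schutz_push (X := ZG^o) (U := ZS^o) ms_incl x.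

Definition schutz_free_inv : ZS -> M :=
  mlift (fun s => if `[< Lclass e s >] then gen _ (tr_ix tr s) (tr_grp tr s) else 0).

Lemma schutz_free_gen j g :
  schutz_free_map (gen _ j g) = mr (tr_rep tr j * sval g).
Proof.
rewrite /schutz_free_map /schutz_push (bigD1 j) //= big1 => [|i ne_ij].
  by rewrite addr0 of_coefE eqxx ms_incl_mr; apply: mrM.
by rewrite of_coefE (negPf ne_ij) ms_incl0; apply: mulr0.
Qed.

Hypothesis S_regular : regular_monoid S.
Hypothesis S_left : finite_set [set I : set S | left_ideal I]%classic.

(** As a module over ZS, the induced module of ZG is ZL = Z[Se]/Z[Se - L], a
    quotient of two left ideals of the monoid ring. *)
Lemma schutz_free_FPq n : FPqT n M.
Proof.
pose Se := zspan (left_multiple e) : ZS^o -> Prop.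
pose below s := left_multiple e s /\ ~ Lclass e s.
pose Sb := zspan below : ZS^o -> Prop.
have lE := @left_closed_multiple S e.
have lb : left_closed below.
  move=> s t [et ntL]; split; first exact: lE.
  by move/(Lclass_mull et).
have sE : submod Se := submod_zspan lE.
have sb : submod Sb := submod_zspan lb.
have mapB x y : schutz_free_map (x - y) = schutz_free_map x - schutz_free_map y.
  apply: (addIr (schutz_free_map y)); rewrite subrK.
  by rewrite /schutz_free_map -schutz_pushD ?subrK //; exact: ms_inclD.
have map0 : schutz_free_map 0 = 0 by apply: schutz_push0; exact: ms_inclD.
have mapK x : schutz_free_inv (schutz_free_map x) = x.
  elim/induced_ind: x => [|x y IHx IHy|j g].
  - by rewrite map0; exact: mlift0.
  - by rewrite mapB [LHS]mliftB [mlift _ _]IHx [mlift _ (schutz_free_map y)]IHy.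
  rewrite schutz_free_gen [LHS]mlift_mr tr_ixK tr_grpK asboolT //.
  by apply/Lclass_mulG; rewrite (Lclass_idr ee (tr_repL tr j)); apply: tr_repL.
have inv_below : forall u, Sb u -> schutz_free_inv u = 0.
  apply: (zspan_ind (P := below)) => [|u v u0 v0|k [_ nkL]]; first exact: mlift0.
    by rewrite [LHS]mliftB [mlift _ _]u0 [mlift _ v]v0 subrr.
  by rewrite [LHS]mlift_mr asboolF.
apply: (FPq_pull (f := schutz_free_map) (A' := Se) (B' := Sb)).
  split=> //.
  - suff lin : linear_mod (ind (rho := schutz tr) (fun _ : ZG^o => True)) Sb
        schutz_free_map by move=> c x y _ _; apply: lin.
    apply: (@schutz_push_linear _ _ _ _ ZG^o ZS^o _ _ ms_inclD ms_incl_act _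
      (submod_full _) sb) => s x es nsL _.
    elim/mr_ind: x => [|x y IHx IHy|g].
    + by rewrite ms_incl0 scaler0; apply: zspan0.
    + by rewrite ms_inclB [_ *: _]scalerBr; apply: zspanB.
    rewrite ms_incl_mr.
    have -> : mr s *: (mr (sval g) : ZS^o) = mr (s * sval g)%g := mrM s (sval g).
    apply: zspanU; split; first by exists (s * sval g)%g; rewrite -mulgA ms_idr.
    move/Lclass_mulG; case: es nsL => t ->; by rewrite -mulgA ee.
  - elim/induced_ind => [_|x y IHx IHy _|j g _].
    + by rewrite map0; apply: zspan0.
    + by rewrite mapB; apply: zspanB; [apply: IHx|apply: IHy].
    rewrite schutz_free_gen; apply: zspanU.
    by exists (tr_rep tr j * sval g)%g; rewrite -mulgA ms_idr.
  - move=> x _; split=> [->|/(inv_below _)]; first by rewrite map0; apply: zspan0.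
    by rewrite mapK.
  move=> v Ev; exists (schutz_free_inv v); split=> //.
  move: v Ev; apply: (zspan_ind (P := left_multiple e)) => [|u v IHu IHv|k ek].
  - by rewrite /schutz_free_inv mlift0 map0; apply: (eqmod_refl sb).
  - by rewrite /schutz_free_inv mliftB mapB; apply: (eqmodB sb).
  rewrite /schutz_free_inv mlift_mr.
  have [kL|nkL] := pselect (Lclass e k).
    by rewrite asboolT // schutz_free_gen trK //; apply: (eqmod_refl sb).
  by rewrite asboolF // map0 /eqmod subr0; apply: zspanU.
apply: (FPq_quot sE sb (submod_zero _)) => [u|u ->||m _].
- by apply: zspanS => k [].
- exact: zspan0.
- exact: left_ideal_FPq.
exact: left_ideal_FPq.
Qed.

End SchutzFree.

(** * The part fixed by an idempotent *)

(** The subgroup eU of a ZS-module U is not a ZS-submodule, but e acts on it as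
    the identity, so it is a module over the ring of the group G of e. *)
Section FixedPart.
Variables (S : monoidType) (e : S) (ee : (e * e)%g = e).
Variable U : lmodType (monoid_ring S).
Local Notation G := (maximal_subgroup ee).

Definition fixed_by : {pred U} := fun u => mr e *: u == u.

Fact fixed_by_zmod_closed : zmod_closed fixed_by.
Proof.
split=> [|u v]; rewrite !unfold_in /fixed_by ?scaler0 //.
by move=> /eqP eu /eqP ev; rewrite scalerBr eu ev.
Qed.
HB.instance Definition _ := GRing.isZmodClosed.Build U fixed_by
  fixed_by_zmod_closed.

Record fixed_part := FixedPart { fixed_val :> U; _ : fixed_val \in fixed_by }.
HB.instance Definition _ := [isSub for fixed_val].
HB.instance Definition _ := [Choice of fixed_part by <:].
HB.instance Definition _ := [SubChoice_isSubZmodule of fixed_part by <:].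

Lemma fixed_valP (v : fixed_part) : mr e *: fixed_val v = fixed_val v.
Proof. by case: v => u /= /eqP. Qed.

Fact fixed_act_subproof s : (e * s = s)%g -> forall u : U,
  mr s *: u \in fixed_by.
Proof. by move=> es u; rewrite unfold_in /fixed_by scalerA mrM es. Qed.

Definition fixed_act (g : G) (v : fixed_part) : fixed_part :=
  FixedPart (fixed_act_subproof (ms_idl g) (fixed_val v)).

Fact fixed_act1 v : fixed_act 1%g v = v.
Proof. by apply: val_inj; apply: fixed_valP. Qed.

Fact fixed_actM g h v : fixed_act (g * h)%g v = fixed_act g (fixed_act h v).
Proof. by apply: val_inj; rewrite /= scalerA mrM. Qed.

Fact fixed_actD g v w : fixed_act g (v + w) = fixed_act g v + fixed_act g w.
Proof. by apply: val_inj; rewrite /= scalerDr. Qed.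

Definition fixed_module : lmodType (monoid_ring G) :=
  action_module (MaddAction fixed_act1 fixed_actM fixed_actD).

Definition fixed_inj (v : fixed_module) : U := fixed_val v.

Lemma fixed_inj_inj : injective fixed_inj.
Proof. exact: val_inj. Qed.

Lemma fixed_injG g v : fixed_inj (mr g *: v) = mr (sval g) *: fixed_inj v.
Proof. by rewrite [mr g *: v]scale_mr. Qed.

Definition fixed_of (u : U) : fixed_module :=
  FixedPart (fixed_act_subproof ee u).

Lemma fixed_ofE u : fixed_inj (fixed_of u) = mr e *: u.
Proof. by []. Qed.

End FixedPart.

(** * Modules that are finitely generated over the integers *)

Lemma lattice_finType (U : zmodType) (A : U -> Prop) (J : finType)
    (f : U -> J -> int) :
  (forall j, additive_on A (fun u => f u j)) ->
  (forall u, A u -> (forall j, f u j = 0) -> u = 0) -> lattice A.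
Proof.
move=> fB f0; exists #|J|, (fun u i => f u (enum_val i)); split=> [i|u Au u0].
  exact: fB.
by apply: f0 => // j; rewrite -(enum_rankK j); apply: u0.
Qed.

Section Annihilator.
Variables (S : monoidType) (U : lmodType (monoid_ring S)) (A B : U -> Prop).
Hypotheses (sA : submod A) (sB : submod B).

Definition annih : set S := [set s | forall u, A u -> B (mr s *: u)]%classic.

Lemma annih_mull s t : annih t -> annih (s * t)%g.
Proof.
by move=> tB u Au; rewrite -mrM -scalerA; apply: (submodZ sB); apply: tB.
Qed.

Lemma annih_mulr s t : annih s -> annih (s * t)%g.
Proof.
by move=> sAB u Au; rewrite -mrM -scalerA; apply: sAB; apply: submodZ.
Qed.

Lemma annih_left_ideal s : annih s -> left_ideal annih.
Proof. by move=> As; split; [exists s|exact: annih_mull]. Qed.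

End Annihilator.

Section Main.
Variable S : monoidType.
Local Notation ZS := (monoid_ring S).
Hypotheses (S_regular : regular_monoid S)
  (S_left : finite_set [set I : set S | left_ideal I]%classic)
  (S_right : finite_set [set I : set S | right_ideal I]%classic).

Lemma expg_cancel (t e x : S) n : (e * x = x)%g -> (t * x = e)%g ->
  (t ^+ n * (e * x ^+ n) = e)%g.
Proof.
move=> ex tx; elim: n => [|n IHn]; first by rewrite !expg0 mul1g mulg1.
rewrite expgSr [(x ^+ _.+1)%g]expgS [(e * _)%g]mulgA ex -mulgA [(t * _)%g]mulgA tx.
exact: IHn.
Qed.

(** Stability: the right ideals e x^n S form a decreasing chain, which becomes
    stationary; cancelling x^n on the left gives e in xS. *)
Lemma Lclass_stable (e l : S) (ee : (e * e)%g = e) : Lclass e (e * l)%g ->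
  exists g : maximal_subgroup ee, (e * l)%g = sval g.
Proof.
set x := (e * l)%g => xL; have [_ [t tx]] := xL.
have ex : (e * x)%g = x by rewrite /x mulgA ee.
pose f n := principal_right_ideal (e * x ^+ n)%g.
have [n fn] : exists n, (f n `<=` f n.+1)%classic.
  suff H (X : set S) : forall n, f n = X -> exists n, (f n `<=` f n.+1)%classic.
    exact: (H _ 0%N).
  pose lt (X Y : set S) := (Y `<=` X)%classic /\ ~ (X `<=` Y)%classic.
  apply: (@finite_ind _ _ lt
    (fun X => forall n, f n = X -> exists n, (f n `<=` f n.+1)%classic)
    S_right) => {}X => [[]//|Y Z [YX nXY] [ZY nYZ]|IH n fX].
    split; first exact: subset_trans YX.
    by move=> XZ; apply: nXY; apply: subset_trans ZY.
  have [sub|nsub] := pselect (f n `<=` f n.+1)%classic; first by exists n.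
  apply: (IH (f n.+1) _ _ n.+1 erefl).
    split; first by exists (e * x ^+ n.+1 * 1)%g; exists 1%g.
    by move=> s _ [u _ <-]; exists (u * s)%g => //; rewrite mulgA.
  split; last by rewrite -fX.
  move=> _ [s _ <-]; rewrite -fX; exists (x * s)%g => //.
  by rewrite expgSr !mulgA.
have [] := fn (e * x ^+ n)%g; first by exists 1%g => //; rewrite mulg1.
move=> s _ E; suff Hx : Hclass e x by exists (exist _ x (mem_set Hx)).
have eE : e = (x * s)%g.
  have {1}<- := expg_cancel n ex (esym tx); rewrite -E.
  have -> : (t ^+ n * (e * x ^+ n.+1 * s) = t ^+ n * (e * x ^+ n) * (x * s))%g.
    by rewrite expgSr !mulgA.
  by rewrite (expg_cancel n ex (esym tx)) mulgA ex.
split; [apply/greenLP|apply/greenRP]; split.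
- by exists t.
- by exists x; rewrite (Lclass_idr ee xL).
- by exists s.
- by exists x; rewrite ex.
Qed.

(** Take Sx minimal among the principal left ideals not contained in Z;
    regularity provides an idempotent generator. *)
Lemma minimal_idempotent (Z : S -> Prop) :
  (forall s x, Z x -> Z (s * x)%g) -> ~ Z 1%g ->
  exists e, [/\ (e * e)%g = e, ~ Z e
    & forall y, left_multiple e y -> ~ Z y -> left_multiple y e].
Proof.
move=> ZM nZ1.
pose lt (X Y : set S) := (Y `<=` X)%classic /\ ~ (X `<=` Y)%classic.
suff H (X : set S) x : principal_left_ideal x = X -> ~ Z x ->
  exists e, [/\ (e * e)%g = e, ~ Z e
    & forall y, left_multiple e y -> ~ Z y -> left_multiple y e].
  exact: (H _ 1%g erefl).
move: X x; apply: (@finite_ind _ _ lt (fun X => forall x, principal_left_ideal x = X ->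
    ~ Z x -> _) S_left) => X => [[]//|Y W [YX nXY] [WY nYW]|IH x xX nZx].
  split; first exact: subset_trans YX.
  by move=> XW; apply: nXY; apply: subset_trans WY.
have [[y [xy nZy nyx]]|no] := pselect (exists y, [/\ left_multiple x y, ~ Z y
    & ~ left_multiple y x]).
  apply: (IH (principal_left_ideal y)) nZy => //.
    split; first by exists (1 * y)%g; exists 1%g.
    by move=> s _ [u _ <-]; exists (s * u)%g => //; rewrite mulgA.
  case: xy => s yE; split.
    by move=> _ [u _ <-]; rewrite -xX; exists (u * s)%g => //; rewrite yE mulgA.
  rewrite -xX => /(_ x) []; first by exists 1%g => //; rewrite mul1g.
  by move=> u _ xE; apply: nyx; exists u.
have [e [ee xe ex]] := regular_idempotent S_regular x.
exists e; split=> // [Ze|y ey nZy]; first by case: ex nZx => s -> []; apply: ZM.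
apply: (left_multiple_trans _ xe); apply: contrapT => nyx.
case: no; exists y; split=> //; exact: left_multiple_trans xe ey.
Qed.

Variable n : nat.
Hypothesis G_FP : forall (e : S) (ee : (e * e)%g = e),
  FPqT n (trivial_module (maximal_subgroup ee)).

(** Induction on the annihilator of M = A/B, upwards. If M is nonzero, choose an
    idempotent e that does not annihilate M, with Se minimal for this; then
    everything in Se outside the L-class of e annihilates M, so that
    r (x) u |-> r u is a map phi from ZL (x)_ZG eM to M. Both the cokernel and
    the kernel of phi are annihilated by e as well as by the annihilator of M,
    hence are FP_n by induction, while ZL (x)_ZG eM is FP_n because eM is so over
    ZG. *)
Lemma lattice_quot_FPq (U : lmodType ZS) (A B : U -> Prop) :
  submod A -> submod B -> (forall u, B u -> A u) -> lattice A -> FPq n A B.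
Proof.
move: U A B.
suff H (X : set S) (U : lmodType ZS) (A B : U -> Prop) : annih A B = X ->
    submod A -> submod B -> (forall u, B u -> A u) -> lattice A -> FPq n A B.
  by move=> U A B; apply: (H _ U A B erefl).
pose lt (X Y : set S) := (X `<=` Y)%classic /\ ~ (Y `<=` X)%classic.
move: X U A B; apply: (@finite_ind _ _ lt (fun X => forall (U : lmodType ZS)
    (A B : U -> Prop), annih A B = X -> _) S_left)
  => X => [[]//|Y W [XY nYX] [YW nWY]|IH U A B annX sA sB BA latA].
  split; first exact: subset_trans YW.
  by move=> WX; apply: nYX; apply: subset_trans WX.
have [Z1|nZ1] := pselect (annih A B 1%g).
  by apply: FPq_trivial => // u Au; rewrite -[u]scale1r; apply: Z1.
have [s x|e [ee nZe minE]] := @minimal_idempotent (annih A B) _ nZ1.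
  exact: annih_mull.
have IHe (U' : lmodType ZS) (A' B' : U' -> Prop) :
    submod A' -> submod B' -> (forall u, B' u -> A' u) -> lattice A' ->
    (forall s, annih A B s -> annih A' B' s) -> annih A' B' e -> FPq n A' B'.
  move=> sA' sB' BA' latA' ZZ' Z'e.
  apply: (IH (annih A' B')) => //; first exact: annih_left_ideal Z'e.
  by rewrite -annX; split=> // ZZ; apply/nZe/ZZ.
have below s : left_multiple e s -> ~ Lclass e s -> annih A B s.
  move=> es nsL; apply: contrapT => nZs; apply: nsL; split=> //; exact: minE.
have LnZ s : Lclass e s -> ~ annih A B s.
  by move=> [_ [t et]] Zs; apply: nZe; rewrite et; apply: annih_mull.
have [tr _] := transversal_exists ee S_right.
pose V := fixed_module ee U.
pose kap : V -> U := @fixed_inj S e ee U.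
pose AV (v : V) := A (kap v); pose BV (v : V) := B (kap v).
have subV (C : U -> Prop) : submod C -> submod (fun v : V => C (kap v)).
  move=> sC; apply: submod_mr => [|u v Cu Cv|g v Cv].
  - exact: submod0.
  - exact: submodB.
  by rewrite /kap fixed_injG; apply: submodZ.
have sAV : submod AV := subV _ sA.
have sBV : submod BV := subV _ sB.
have [r [f [fB f0]]] := latA.
have latAV : lattice AV.
  exists r, (fun v => f (kap v)); split=> [i u v Au Av|v Av v0].
    exact: fB.
  by apply: fixed_inj_inj; apply: f0.
have latBV : lattice BV by apply: latticeS latAV => v; apply: BA.
have FPV : FPq n AV BV.
  have FPA := group_lattice_FPq sAV latAV (G_FP ee).
  have FPB := group_lattice_FPq sBV latBV (G_FP ee).
  apply: (FPq_quot sAV sBV (submod_zero _)) => // [v /BA//|v ->|m nE].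
    exact: submod0.
  by move: FPB; rewrite nE; apply: FPq_mono.
(* IA/IB below is ZL (x)_ZG eM, where eM = AV/BV. *)
have FPind : FPq n (ind (rho := schutz tr) AV) (ind BV).
  by apply: induced_FPq => //; apply: schutz_free_FPq.
pose IA := ind (rho := schutz tr) AV; pose IB := ind (rho := schutz tr) BV.
have sIA : submod IA := submod_ind (schutz tr) sAV.
have sIB : submod IB := submod_ind (schutz tr) sBV.
pose phi : induced (schutz tr) V -> U := schutz_push kap.
have kapD : forall x y, kap (x + y) = kap x + kap y by [].
have kapG := @fixed_injG S e ee U.
have phi0 : phi 0 = 0 := schutz_push0 tr kapD.
have phiD x y : phi (x + y) = phi x + phi y := schutz_pushD kapD x y.
have phiB x y : phi (x - y) = phi x - phi y.
  by apply: (addIr (phi y)); rewrite -phiD !subrK.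
have phi_lin : linear_mod IA B phi.
  apply: (schutz_push_linear (kappa := kap)) => // s x es nsL Ax.
  by apply: below.
have phi_act s x : IA x -> eqmod B (phi (mr s *: x)) (mr s *: phi x).
  move=> Ax; have := phi_lin (mr s) x 0 Ax (submod0 sIA).
  by rewrite !addr0 phi0 addr0.
have phiA x : IA x -> A (phi x).
  by move=> Ax; apply: submod_sum => // i; apply: submodZ => //; apply: Ax.
(* K/IB is the kernel of phi on IA/IB. *)
pose K x := IA x /\ B (phi x).
have sK : submod K.
  apply: submod_mr => [|x y [Ax Bx] [Ay By]|s x [Ax Bx]]; split.
  - exact: (submod0 sIA).
  - by rewrite phi0; apply: submod0.
  - exact: (submodB sIA).
  - by rewrite phiB; apply: submodB.
  - exact: (submodZ sIA).
  by apply/(submod_eqmod sB (phi_act s x Ax)); apply: submodZ.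
have IBK x : IB x -> K x.
  move=> Bx; split=> [i|]; first exact/BA/Bx.
  by apply: submod_sum => // i; apply: submodZ => //; apply: Bx.
have latK : lattice K.
  apply: (@lattice_finType _ K (tr_index tr * 'I_r)%type
    (fun x p => f (kap (coef x p.1)) p.2)) => [[i j] x y [Ax _] [Ay _]|x [Ax _] x0].
    by rewrite coefB; apply: fB; [apply: Ax|apply: Ay].
  apply/coefP => i; rewrite coef0; apply: fixed_inj_inj.
  by apply: f0 => [|j]; [apply: Ax|apply: (x0 (i, j))].
have FPK : FPq n K IB.
  apply: IHe => // [s Zs x _ i|x [Ax Bx]].
    rewrite coef_scale big1 => [|j _]; first exact: (submod0 sBV).
    rewrite /= schutz_out ?scale0r // => /LnZ; apply.
    exact: (annih_mulr sA).
  (* By stability e r_j is in L only if it is in G, hence only if its R-class is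
     that of e: all coordinates of e x but one vanish, and on the remaining one
     phi is injective modulo B. *)
  set w := mr e *: x; pose i0 := tr_ix tr e.
  have w0 i : i != i0 -> coef w i = 0.
    move=> ne_i; rewrite coef_scale big1 // => j _.
    have [eL|neL] := pselect (Lclass e (e * tr_rep tr j)%g); last first.
      by rewrite /= schutz_out // scale0r.
    rewrite /= schutz_ne ?scale0r //; have [g gE] := Lclass_stable ee eL.
    have -> : (e * tr_rep tr j = tr_rep tr i0 * sval (tr_grp tr e * g)%g)%g.
      by rewrite gE [RHS]mulgA (trK tr (Lclass_id e)) ms_idl.
    by rewrite tr_ixK eq_sym.
  have Bw : B (phi w) by apply/(submod_eqmod sB (phi_act e x Ax)); apply: submodZ.
  have [_ [t et]] := tr_repL tr i0.
  have Bw0 : B (kap (coef w i0)).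
    have := submodZ sB (mr t) Bw.
    rewrite /phi /schutz_push (bigD1 i0) //= big1 => [|i /w0 ->]; last first.
      by rewrite (kappa0 kapD) scaler0.
    by rewrite addr0 scalerA mrM -et fixed_valP.
  move=> i; have [->//|/w0 wi] := eqVneq i i0.
  by rewrite wi; apply: (submod0 sBV).
(* Im/B is the image of phi, and A/Im its cokernel. *)
pose Im u := A u /\ exists x, IA x /\ eqmod B u (phi x).
have sIm : submod Im.
  apply: submod_mr => [|u v [Au [x [Ax ux]]] [Av [y [Ay vy]]]|s u [Au [x [Ax ux]]]]; split.
  - exact: submod0.
  - by exists 0; rewrite phi0; split; [apply: (submod0 sIA)|apply: (eqmod_refl sB)].
  - exact: submodB.
  - exists (x - y); rewrite phiB; split; first exact: (submodB sIA).
    exact: (eqmodB sB).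
  - exact: submodZ.
  exists (mr s *: x); split; first exact: (submodZ sIA).
  apply: (eqmod_trans sB (eqmodZ sB (mr s) ux)).
  exact: (eqmod_sym sB (phi_act s x Ax)).
have BIm u : B u -> Im u.
  move=> Bu; split; first exact: BA.
  by exists 0; rewrite phi0 /eqmod subr0; split=> //; apply: (submod0 sIA).
have FPIm : FPq n Im B.
  apply: (FPq_push (f := phi) (A := IA) (B := K)).
    split=> // [x Ax|x Ax|u [_ //]]; last by split=> [[]|].
    by split; [apply: phiA|exists x; split=> //; apply: eqmod_refl].
  apply: (FPq_quot sIA sK sIB) => // [x []//|m nE].
  by move: FPK; rewrite nE; apply: FPq_mono.
have FPA : FPq n A Im.
  apply: IHe => // [u []//|s Zs u Au|u Au].
    exact/BIm/Zs.
  split; first exact: submodZ.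
  pose x : induced (schutz tr) V := of_coef _ (fun i =>
    if i == tr_ix tr e then mr (tr_grp tr e) *: (fixed_of ee u : V) else 0).
  exists x; split.
    move=> i; rewrite of_coefE; case: eqP => _; last exact: (submod0 sAV).
    by apply: (submodZ sAV); rewrite /AV /kap fixed_ofE; apply: submodZ.
  rewrite /phi /schutz_push (bigD1 (tr_ix tr e)) //= big1 => [|i /negPf ne_i].
    rewrite addr0 of_coefE eqxx [kap _]fixed_injG fixed_ofE !scalerA !mrM.
    by rewrite (trK tr (Lclass_id e)) ee; apply: (eqmod_refl sB).
  by rewrite of_coefE ne_i (kappa0 kapD) scaler0.
apply: (FPq_ext sA sIm sB) FPA => // u; by case.
Qed.

End Main.

Theorem corollary1 (S : monoidType)
    (S_fp : finitely_presented S)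
    (S_regular : regular_monoid S)
    (S_left : finite_set [set I : set S | left_ideal I])
    (S_right : finite_set [set I : set S | right_ideal I])
    (S_FP3 : forall (e : S) (ee : (e * e)%g = e), FP 3 (maximal_subgroup ee)) :
  FP 3 S.
Proof.
apply: FPq_FP; apply: lattice_quot_FPq => //.
- by move=> e ee; apply/FP_FPq/S_FP3.
- exact: submod_zero.
- by exists 1%N, (fun z _ => z); split=> // u _ /(_ ord0).
Qed.
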